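(* Let $\Delta,w\in\mathbb{C}\{x,y\}$ with $w(0,0)\neq 0=\Delta(0,0)$ and let $\varphi_{\Delta,w}(x,y)=(x+y(y-x)\Delta(x,y),\,y+y(y-x)w(x,y))$. If the formal class of $\varphi_{\Delta,w}$ is embeddable, then the transport mapping $Tr_{\Delta,w}$ is an analytic mapping (i.e. its power series converges).
   Context: A formal vector field on $(\mathbb{C}^2,0)$ is a derivation of $\mathbb{C}[[x,y]]$; it is nilpotent if it vanishes at $0$ and its linear part is nilpotent. A formal diffeomorphism is a pair of formal power series without constant term with invertible linear part; it is unipotent if $1$ is the only eigenvalue of its linear part. For a unipotent formal diffeomorphism $\varphi$, $\log\varphi$ is the unique formal nilpotent vector field $X$ with $g\circ\varphi=\sum_{j\ge0}X^j(g)/j!$ for all $g\in\mathbb{C}[[x,y]]$. The formal class of a unipotent germ $\varphi$ is embeddable if $\log\varphi$ is formally conjugated to a convergent germ of vector field (formal conjugacy by $\hat\sigma$: $(\hat\sigma_*X)(g)=[X(g\circ\hat\sigma)]\circ\hat\sigma^{-1}$). Transport mapping: a formal first integral of a formal vector field $Y$ is $\hat f\in\mathbb{C}[[x,y]]$ with $Y(\hat f)=0$; it is primitive if $\sqrt[k]{\hat f}\notin\mathbb{C}[[x,y]]$ for all $k>1$. The vector field $\log\varphi_{\Delta,w}$ has primitive formal first integrals $\hat f$, and for any of them $\hat f(x,0)$ and $\hat f(x,x)$ are formal diffeomorphisms of $(\mathbb{C},0)$. $Tr_{\Delta,w}:(y=0)\to(y=x)$ is the unique formal mapping with $\hat f\circ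 Tr_{\Delta,w}=\hat f$ on $y=0$; explicitly $Tr_{\Delta,w}(x,0)=(\hat a(x),\hat a(x))$ with $\hat a=(\hat f(x,x))^{(-1)}\circ\hat f(x,0)$, where $(-1)$ denotes compositional inverse. It does not depend on the choice of $\hat f$. *)

(* Defs.v *)
From HB Require Import structures.
From mathcomp Require Import all_boot all_order all_algebra.
From mathcomp Require Import complex.
From mathcomp Require Import all_classical all_reals all_analysis.

Set Implicit Arguments.
Unset Strict Implicit.
Unset Printing Implicit Defensive.

Import Order.TTheory GRing.Theory Num.Theory.

Local Open Scope ring_scope.

(* A record rather than a bare function type, so that the Cauchy product does
   not compete with the pointwise ring structure on functions. *)
Record fps (A : Type) : Type := Fps { fps_coef :> nat -> A }.
Arguments Fps {A} _%_function_scope.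

HB.instance Definition _ (A : Type) := gen_eqMixin (fps A).
HB.instance Definition _ (A : Type) := gen_choiceMixin (fps A).

Lemma fpsP (A : Type) (f g : fps A) : f =1 g <-> f = g.
Proof. by split=> [|-> //]; case: f g => f [g] /= /funext ->. Qed.

Section FpsRing.
Variable A : comNzRingType.
Implicit Types f g h : fps A.

Definition fpsC (c : A) : fps A := Fps (fun n => if n == 0%N then c else 0).
Definition fpsX : fps A := Fps (fun n => (n == 1%N)%:R).
Definition fps_opp f : fps A := Fps (fun n => - f n).
Definition fps_add f g : fps A := Fps (fun n => f n + g n).
Definition fps_mul f g : fps A :=
  Fps (fun n => \sum_(k < n.+1) f k * g (n - k)%N).

Fact fps_addA : associative fps_add.
Proof. by move=> f g h; apply/fpsP => n /=; rewrite addrA. Qed.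

Fact fps_addC : commutative fps_add.
Proof. by move=> f g; apply/fpsP => n /=; rewrite addrC. Qed.

Fact fps_add0 : left_id (fpsC 0) fps_add.
Proof. by move=> f; apply/fpsP => n /=; rewrite if_same add0r. Qed.

Fact fps_addN : left_inverse (fpsC 0) fps_opp fps_add.
Proof. by move=> f; apply/fpsP => n /=; rewrite if_same addNr. Qed.

HB.instance Definition _ :=
  GRing.isZmodule.Build (fps A) fps_addA fps_addC fps_add0 fps_addN.

Fact fps_mulC : commutative fps_mul.
Proof.
move=> f g; apply/fpsP => n /=; rewrite (reindex_inj rev_ord_inj) /=.
by apply: eq_bigr => k _; rewrite subSS subKn ?leq_ord // mulrC.
Qed.

Fact fps_mulA : associative fps_mul.
Proof.
have rev f g n : fps_mul f g n = \sum_(k < n.+1) f (n - k)%N * g k.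
  by rewrite fps_mulC /=; apply: eq_bigr => k _; rewrite mulrC.
move=> p q r; apply/fpsP=> i; rewrite [RHS]rev /=.
pose coef3 j k := p j * (q (i - j - k)%N * r k).
transitivity (\sum_(j < i.+1) \sum_(k < i.+1 | (k <= i - j)%N) coef3 j k).
  apply: eq_bigr => /= j _.
  have /= -> := rev q r (i - j)%N; rewrite big_distrr /=.
  by rewrite (big_ord_narrow_leq (leq_subr _ _)).
rewrite (exchange_big_dep predT) //=; apply: eq_bigr => k _.
transitivity (\sum_(j < i.+1 | (j <= i - k)%N) coef3 j k).
  apply: eq_bigl => j; rewrite -ltnS -(ltnS j) -!subSn ?leq_ord //.
  by rewrite -subn_gt0 -(subn_gt0 j) -!subnDA addnC.
rewrite (big_ord_narrow_leq (leq_subr _ _)) big_distrl /=.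
by apply: eq_bigr => j _; rewrite /coef3 -!subnDA addnC mulrA.
Qed.

Fact fps_mul1 : left_id (fpsC 1) fps_mul.
Proof.
move=> f; apply/fpsP => n /=; rewrite big_ord_recl /= mul1r subn0.
by rewrite big1 ?addr0 // => k _; rewrite mul0r.
Qed.

Fact fps_mulDl : left_distributive fps_mul fps_add.
Proof.
move=> f g h; apply/fpsP => n /=; rewrite -big_split /=.
by apply: eq_bigr => k _; rewrite mulrDl.
Qed.

Fact fps_oner_neq0 : fpsC 1 != fpsC 0.
Proof. by apply/eqP => /fpsP /(_ 0%N) /eqP; rewrite /= oner_eq0. Qed.

HB.instance Definition _ := GRing.Zmodule_isComNzRing.Build (fps A)
  fps_mulA fps_mulC fps_mul1 fps_mulDl fps_oner_neq0.

End FpsRing.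

Arguments fpsX {A}.

(* C[[x,y]] is realized as C[[y]][[x]]: the coefficient of x^i y^j in f is
   f i j. *)
Notation fps2 R := (fps (fps R[i])).

Section FormalGerms.
Variable R : realType.
Local Notation C := R[i].
Local Notation fps2 := (fps2 R).

Definition varx : fps2 := fpsX.
Definition vary : fps2 := fpsC fpsX.
Definition cst (c : C) : fps2 := fpsC (fpsC c).

Definition convergent1 (a : fps C) : Prop :=
  exists2 r : R, 0 < r &
    summable [set: nat] (fun n => (Normc.normc (a n) * r ^+ n)%:E).

Definition convergent2 (f : fps2) : Prop :=
  exists2 r : R, 0 < r &
    summable [set: nat * nat]
      (fun k => (Normc.normc (f k.1 k.2) * r ^+ (k.1 + k.2))%:E).

(* Substitutions f(u, v).  When u and v have no constant term, u^i v^j only has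
   terms of total degree >= i + j, so the truncated sums below are the full
   ones; the definitions are only used in that case. *)
Definition subst1 (f : fps2) (u v : fps C) : fps C :=
  Fps (fun n => \sum_(i < n.+1) \sum_(j < n.+1)
    f i j * (u ^+ i * v ^+ j) n).

Definition subst2 (f : fps2) (s : fps2 * fps2) : fps2 :=
  Fps (fun m => Fps (fun n => \sum_(i < (m + n).+1) \sum_(j < (m + n).+1)
    f i j * (s.1 ^+ i * s.2 ^+ j) m n)).

Definition comp2 (s t : fps2 * fps2) : fps2 * fps2 :=
  (subst2 s.1 t, subst2 s.2 t).

Definition linear_part (s : fps2 * fps2) : 'M[C]_2 :=
  \matrix_(k < 2, l < 2)
    (let f := if k == 0 then s.1 else s.2 in
     if l == 0 then f 1%N 0%N else f 0%N 1%N).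

Definition vanishes (s : fps2 * fps2) : Prop :=
  s.1 0%N 0%N = 0 /\ s.2 0%N 0%N = 0.

Definition formal_diffeo (s : fps2 * fps2) : Prop :=
  vanishes s /\ linear_part s \in unitmx.

Definition unipotent (s : fps2 * fps2) : Prop :=
  formal_diffeo s /\ forall c : C, eigenvalue (linear_part s) c = (c == 1).

Definition formal_vector_field (X : fps2 -> fps2) : Prop :=
  [/\ forall f g, X (f + g) = X f + X g,
      forall c f, X (cst c * f) = cst c * X f &
      forall f g, X (f * g) = X f * g + f * X g].

Definition components (X : fps2 -> fps2) : fps2 * fps2 := (X varx, X vary).

Definition nilpotent_field (X : fps2 -> fps2) : Prop :=
  [/\ formal_vector_field X, vanishes (components X) &
      exists k, linear_part (components X) ^+ k = 0].

Definition convergent_field (X : fps2 -> fps2) : Prop :=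
  [/\ formal_vector_field X, convergent2 (X varx) & convergent2 (X vary)].

(* Sum of a series for the Krull topology of C[[x,y]]: every coefficient of the
   partial sums is eventually constant. *)
Definition formal_sum (u : nat -> fps2) (s : fps2) : Prop :=
  forall i j, \forall N \near \oo%classic, (\sum_(k < N) u k) i j = s i j.

Definition is_log (s : fps2 * fps2) (X : fps2 -> fps2) : Prop :=
  [/\ unipotent s, nilpotent_field X &
      forall g, formal_sum (fun k => cst (k`!%:R^-1) * iter k X g)
                           (subst2 g s)].

Definition formally_conjugated (X Y : fps2 -> fps2) : Prop :=
  exists s t : fps2 * fps2,
    [/\ formal_diffeo s, formal_diffeo t,
        comp2 s t = (varx, vary), comp2 t s = (varx, vary) &
        forall g, Y g = subst2 (X (subst2 g s)) t].

Definition embeddable (s : fps2 * fps2) : Prop :=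
  exists X Y, [/\ is_log s X, convergent_field Y & formally_conjugated X Y].

Definition first_integral (X : fps2 -> fps2) (f : fps2) : Prop := X f = 0.

Definition primitive (f : fps2) : Prop :=
  forall k, (1 < k)%N -> ~ exists g : fps2, g ^+ k = f.

Definition phi (Delta w : fps2) : fps2 * fps2 :=
  (varx + vary * (vary - varx) * Delta, vary + vary * (vary - varx) * w).

(* The transport mapping Tr : (y = 0) -> (y = x), Tr (x, 0) = (a(x), a(x)), is
   encoded by the one-variable series a; the last condition is f o Tr = f on
   the line y = 0. *)
Definition is_transport (Delta w : fps2) (a : fps C) : Prop :=
  exists (X : fps2 -> fps2) (f : fps2),
    [/\ is_log (phi Delta w) X, first_integral X f, primitive f,
        a 0%N = 0 & subst1 f a a = subst1 f fpsX 0].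

End FormalGerms.

Arguments varx {R}.
Arguments vary {R}.

(* Main.v *)
(* Let X be the logarithm of the diffeomorphism. It vanishes to order 2 at 0 and
   on both lines y = 0 and y = x; along each of them its transversal eigenvalue
   kappa satisfies exp kappa = 1 - x w(x,0), resp. 1 + x (w - Delta)(x,x), so kappa
   is a convergent series of order 1. A formal conjugacy s to a convergent field W
   sends the lines to curves on which W vanishes and whose transversal eigenvalue
   for W is again kappa. These equations have, after a blow-up, an invertible
   linear part, hence s is convergent on both lines. The convergent map
   psi(x,y) = s(x-y,0) + s(y,y) agrees with s on both lines; pulled back by psi,
   the foliation of W is convergent, has no singularity at 0 after division by
   y (y - x), and has the same transport as X. As the transport is the holonomy of
   this foliation from y = 0 to y = x, it converges. *)

Require Import Defs.
From mathcomp Require Import all_boot all_order all_algebra complex.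
From mathcomp Require Import all_classical all_reals all_analysis.
From mathcomp Require Import ring zify.

Set Implicit Arguments.
Unset Strict Implicit.
Unset Printing Implicit Defensive.

Import Order.TTheory GRing.Theory Num.Theory.

Local Open Scope ring_scope.

(** * Formal power series in two variables *)

(** The conjugacy [s] may diverge off the two lines. This does no harm, because the transport only
    sees the restrictions of a first integral to the lines; so [s] may be replaced by a map with the
    same restrictions that no longer conjugates the fields. What survives the replacement is the
    trace of the linear part along a line of zeros: it is a conjugacy invariant, and it equals kappa
    since the tangential eigenvalue is 0. It is used twice. The equation W = 0 alone is insensitive
    to reparametrization of a curve, and the equation trace = kappa fixes the parameter; the nonzero
    derivative of kappa makes the blown-up system invertible. Later the traces on both lines give
    the values at 0 of the two components of the divided field, which rules out a singularity. Every
    convergence claim concerns a formal solution that is already known, so only bounds are needed: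
    weighted sums of absolute values are estimated, and no holomorphic function occurs. *)

(* An abstract presentation of K[[x,y]] by its coefficients, so that no proof
   depends on how the Cauchy product is computed. *)
Record series (K : fieldType) := Series {
  series_ring :> comNzRingType;
  co : series_ring -> nat -> nat -> K;
  mk : (nat -> nat -> K) -> series_ring;
  co_mk : forall F i j, co (mk F) i j = F i j;
  co_inj : forall f g, (forall i j, co f i j = co g i j) -> f = g;
  coD : forall f g i j, co (f + g) i j = co f i j + co g i j;
  co1 : forall i j, co 1 i j = ((i == 0%N) && (j == 0%N))%:R;
  coM : forall f g i j, co (f * g) i j =
    \sum_(k < i.+1) \sum_(l < j.+1) co f k l * co g (i - k)%N (j - l)%N }.

Lemma sum_delta2 (V : nmodType) (N a b : nat) (F : nat -> nat -> V) :
  \sum_(i < N) \sum_(j < N) (if (i == a :> nat) && (j == b :> nat) then F i j else 0) =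
  if (a < N)%N && (b < N)%N then F a b else 0.
Proof.
case: ifP => [/andP[aN bN]|abN].
  rewrite (bigD1 (Ordinal aN)) //= (bigD1 (Ordinal bN)) //= !eqxx.
  rewrite [X in _ + X + _]big1 ?addr0 => [|j]; last first.
    by rewrite -val_eqE /= => /negPf ->.
  rewrite big1 ?addr0 // => i; rewrite -val_eqE /= => /negPf ia.
  by rewrite big1 // => j _; rewrite ia.
rewrite big1 // => i _; rewrite big1 // => j _; case: ifP => // /andP[/eqP ia /eqP jb].
by rewrite -ia -jb !ltn_ord in abN.
Qed.

Section Formal.
Variables (K : fieldType) (S : series K).
Implicit Types (f g h u v : S) (c : K) (n : nat).

Lemma co0 i j : co (0 : S) i j = 0.
Proof. by apply: (addIr (co (0 : S) i j)); rewrite -coD !add0r. Qed.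

Lemma coN f i j : co (- f) i j = - co f i j.
Proof. by apply/eqP; rewrite -addr_eq0 -coD addNr co0. Qed.

Lemma coB f g i j : co (f - g) i j = co f i j - co g i j.
Proof. by rewrite coD coN. Qed.

Lemma co_sum (I : Type) (r : seq I) (p : pred I) (F : I -> S) i j :
  co (\sum_(k <- r | p k) F k) i j = \sum_(k <- r | p k) co (F k) i j.
Proof.
apply: (big_morph (fun f : S => co f i j)) => [f g|]; first exact: coD.
exact: co0.
Qed.

Definition const c : S := mk S (fun i j => if (i == 0%N) && (j == 0%N) then c else 0).
Definition X : S := mk S (fun i j => ((i == 1%N) && (j == 0%N))%:R).
Definition Y : S := mk S (fun i j => ((i == 0%N) && (j == 1%N))%:R).

Lemma co_const c i j : co (const c) i j = if (i == 0%N) && (j == 0%N) then c else 0.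
Proof. exact: co_mk. Qed.

Lemma co_constM c f i j : co (const c * f) i j = c * co f i j.
Proof.
rewrite coM big_ord_recl big_ord_recl co_const !subn0.
rewrite !big1 ?addr0 // => [k _|k _]; last by rewrite co_const mul0r.
by rewrite big1 // => l _; rewrite co_const mul0r.
Qed.

Lemma co_XM f i j : co (X * f) i j = if i is i'.+1 then co f i' j else 0.
Proof.
rewrite coM; case: i => [|i].
  by rewrite big1 // => k _; rewrite big1 // => l _; rewrite co_mk (ord1 k) mul0r.
rewrite big_ord_recl big1 ?add0r; last by move=> l _; rewrite co_mk mul0r.
rewrite big_ord_recl [X in _ + X]big1 ?addr0; last first.
  by move=> k _; rewrite big1 // => l _; rewrite co_mk mul0r.
rewrite big_ord_recl [X in _ + X]big1 ?addr0; last first.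
  by move=> l _; rewrite co_mk mul0r.
by rewrite co_mk mul1r !subn0 subSS subn0.
Qed.

Lemma co_YM f i j : co (Y * f) i j = if j is j'.+1 then co f i j' else 0.
Proof.
rewrite coM big_ord_recl [X in _ + X]big1 ?addr0; last first.
  by move=> k _; rewrite big1 // => l _; rewrite co_mk mul0r.
case: j => [|j]; first by rewrite big1 // => l _; rewrite co_mk (ord1 l) mul0r.
rewrite big_ord_recl co_mk mul0r add0r big_ord_recl [X in _ + X]big1 ?addr0.
  by rewrite co_mk mul1r !subn0 subSS subn0.
by move=> l _; rewrite co_mk mul0r.
Qed.

Lemma co_XnM a f i j : co (X ^+ a * f) i j = if (a <= i)%N then co f (i - a)%N j else 0.
Proof.
elim: a i => [|a IHa] i; first by rewrite expr0 mul1r subn0.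
by rewrite exprS -mulrA co_XM; case: i => [|i] //; rewrite IHa.
Qed.

Lemma co_YnM b f i j : co (Y ^+ b * f) i j = if (b <= j)%N then co f i (j - b)%N else 0.
Proof.
elim: b j => [|b IHb] j; first by rewrite expr0 mul1r subn0.
by rewrite exprS -mulrA co_YM; case: j => [|j] //; rewrite IHb.
Qed.

Definition mon a b : S := X ^+ a * Y ^+ b.

Lemma co_mon a b i j : co (mon a b) i j = ((i == a) && (j == b))%:R.
Proof.
rewrite /mon co_XnM -[Y ^+ b]mulr1 co_YnM co1.
case: leqP => ai; last by case: eqP ai => [->|//]; rewrite ltnn.
case: leqP => bj; last by rewrite andbC; case: eqP bj => [->|//]; rewrite ltnn.
by rewrite !subn_eq0; congr ((_ && _)%:R); rewrite eqn_leq ?ai ?bj ?andbT.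
Qed.

Lemma constD c d : const (c + d) = const c + const d.
Proof.
by apply: co_inj => i j; rewrite coD !co_const; case: ifP => // _; rewrite addr0.
Qed.

Lemma constM c d : const (c * d) = const c * const d.
Proof.
by apply: co_inj => i j; rewrite co_constM !co_const; case: ifP; rewrite ?mulr0.
Qed.

Lemma const0 : const 0 = 0.
Proof. by apply: co_inj => i j; rewrite co_const co0 if_same. Qed.

Lemma const1 : const 1 = 1.
Proof. by apply: co_inj => i j; rewrite co_const co1; case: ifP. Qed.

Lemma constN c : const (- c) = - const c.
Proof. by apply/eqP; rewrite -addr_eq0 -constD addNr const0. Qed.

(* [inm n] is the n-th power of the maximal ideal. *)
Definition inm n f := forall i j, (i + j < n)%N -> co f i j = 0.

Lemma inm0 f : inm 0 f. Proof. by []. Qed.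
Lemma inm_zero n : inm n 0. Proof. by move=> i j _; rewrite co0. Qed.

Lemma inm_leq n m f : (n <= m)%N -> inm m f -> inm n f.
Proof. by move=> nm fm i j ijn; apply: fm; apply: leq_trans nm. Qed.

Lemma inmD n f g : inm n f -> inm n g -> inm n (f + g).
Proof. by move=> fn gn i j ij; rewrite coD fn ?gn ?addr0. Qed.

Lemma inmN n f : inm n f -> inm n (- f).
Proof. by move=> fn i j ij; rewrite coN fn ?oppr0. Qed.

Lemma inmB n f g : inm n f -> inm n g -> inm n (f - g).
Proof. by move=> fn gn; apply: inmD => //; apply: inmN. Qed.

Lemma inm_sum (I : Type) (r : seq I) (p : pred I) (F : I -> S) n :
  (forall k, p k -> inm n (F k)) -> inm n (\sum_(k <- r | p k) F k).
Proof. by move=> Fn i j ij; rewrite co_sum big1 // => k /Fn; apply. Qed.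

Lemma inmM n m f g : inm n f -> inm m g -> inm (n + m) (f * g).
Proof.
move=> fn gm i j ij; rewrite coM big1 // => k _; rewrite big1 // => l _.
have [kl|kl] := ltnP (k + l) n; first by rewrite fn ?mul0r.
rewrite gm ?mulr0 //; have := ltn_ord k; have := ltn_ord l; lia.
Qed.

Lemma inmMl n f g : inm n g -> inm n (f * g).
Proof. exact: (@inmM 0). Qed.

Lemma inmMr n f g : inm n f -> inm n (f * g).
Proof. by rewrite mulrC; apply: inmMl. Qed.

Lemma inmX n f : inm 1 f -> inm n (f ^+ n).
Proof.
by move=> f1; elim: n => [|n IHn]; [exact: inm0 | rewrite exprS; apply: (inmM f1)].
Qed.

Lemma inmX1 : inm 1 X.
Proof.
by move=> i j ij; rewrite -[X]mulr1 co_XM; case: i ij.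
Qed.

Lemma inmY1 : inm 1 Y.
Proof.
by move=> i j ij; rewrite -[Y]mulr1 co_YM; case: j ij => // j; rewrite addnS.
Qed.

Lemma inm_eq0 f : (forall n, inm n f) -> f = 0.
Proof. by move=> fn; apply: co_inj => i j; rewrite co0 (fn (i + j).+1). Qed.

Lemma inm1P f : inm 1 f <-> co f 0%N 0%N = 0.
Proof.
split=> [|f0 i j]; first exact.
by rewrite ltnS leqn0 addn_eq0 => /andP[/eqP-> /eqP->].
Qed.

Definition divx f : S := mk S (fun i j => co f i.+1 j).
Definition divy f : S := mk S (fun i j => co f i j.+1).
Definition at_x0 f : S := mk S (fun i j => if i == 0%N then co f i j else 0).
Definition at_y0 f : S := mk S (fun i j => if j == 0%N then co f i j else 0).

Lemma at_y0_divy f : f = at_y0 f + Y * divy f.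
Proof.
by apply: co_inj => i [|j]; rewrite coD co_YM /at_y0 /divy !co_mk /= ?addr0 ?add0r.
Qed.

Lemma inm_split n f : inm n.+1 f -> f = X * divx f + Y * divy (at_x0 f).
Proof.
move=> fn; apply: co_inj => [[|i]] [|j]; rewrite coD co_XM co_YM /divx /divy ?co_mk /= ?co_mk /= ?addr0 ?add0r //.
by rewrite fn.
Qed.

Lemma inm_divx n f : inm n.+1 f -> inm n (divx f).
Proof. by move=> fn i j ij; rewrite /divx co_mk; apply: fn; rewrite addSn. Qed.

Lemma inm_divy n f : inm n.+1 f -> inm n (divy f).
Proof. by move=> fn i j ij; rewrite /divy co_mk; apply: fn; rewrite addnS. Qed.

Lemma inm_at_x0 n f : inm n f -> inm n (at_x0 f).
Proof.
by move=> fn i j ij; rewrite /at_x0 co_mk; case: ifP => // _; apply: fn.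
Qed.

(** An additive map that loses at most [d] orders is continuous for the Krull topology, hence
    determined by its values on monomials: truncating [f] at order [n + d] changes [T f] by an
    element of order [n]. *)
Lemma cont_eq0 (T : S -> S) d :
    (forall f g, T (f + g) = T f + T g) ->
    (forall n f, inm (n + d) f -> inm n (T f)) ->
    (forall c a b, T (const c * mon a b) = 0) ->
  forall f, T f = 0.
Proof.
move=> TD Tc Tm f.
have T0 : T 0 = 0 by apply: (addIr (T 0)); rewrite -TD !add0r.
apply: inm_eq0 => n.
pose p := \sum_(a < n + d) \sum_(b < n + d) const (co f a b) * mon a b.
have -> : f = p + (f - p) by rewrite addrC subrK.
have Tsum (I : Type) (r : seq I) (F : I -> S) :
  T (\sum_(k <- r) F k) = \sum_(k <- r) T (F k) by apply: big_morph.
rewrite TD {1}/p Tsum big1 ?add0r; last first.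
  by move=> a _; rewrite Tsum big1 // => b _; rewrite Tm.
apply: Tc => i j ij; rewrite coB {}/p co_sum.
have id : (i < n + d)%N by lia.
have jd : (j < n + d)%N by lia.
under eq_bigr => a _.
  rewrite co_sum; under eq_bigr => b _.
    rewrite co_constM co_mon mulr_natr mulrb [i == _]eq_sym [j == _]eq_sym.
    over.
  over.
by rewrite (@sum_delta2 _ _ i j (fun a b => co f a b)) id jd subrr.
Qed.

Lemma cont_eq (T U : S -> S) d :
    (forall f g, T (f + g) = T f + T g) -> (forall f g, U (f + g) = U f + U g) ->
    (forall n f, inm (n + d) f -> inm n (T f)) ->
    (forall n f, inm (n + d) f -> inm n (U f)) ->
    (forall c a b, T (const c * mon a b) = U (const c * mon a b)) ->
  forall f, T f = U f.
Proof.
move=> TD UD Tc Uc TU f; apply/eqP; rewrite -subr_eq0; apply/eqP.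
apply: (@cont_eq0 (fun f => T f - U f) d) => [g h|n g gn|c a b].
- by rewrite TD UD; ring.
- by apply: inmB; [apply: Tc | apply: Uc].
- by rewrite TU subrr.
Qed.

(** * Substitution of a pair of series *)

Definition subs f u v : S := mk S (fun m n =>
  \sum_(i < (m + n).+1) \sum_(j < (m + n).+1) co f i j * co (u ^+ i * v ^+ j) m n).

Lemma subsD f g u v : subs (f + g) u v = subs f u v + subs g u v.
Proof.
apply: co_inj => m n; rewrite coD /subs !co_mk -big_split; apply: eq_bigr => i _ /=.
by rewrite -big_split; apply: eq_bigr => j _ /=; rewrite coD mulrDl.
Qed.

Lemma inm_monomial u v i j : inm 1 u -> inm 1 v -> inm (i + j) (u ^+ i * v ^+ j).
Proof. by move=> u1 v1; apply: inmM; apply: inmX. Qed.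

Lemma inm_subs n f u v :
  inm 1 u -> inm 1 v -> inm n f -> inm n (subs f u v).
Proof.
move=> u1 v1 fn a b ab; rewrite /subs co_mk big1 // => i _; rewrite big1 // => j _.
have [ijn|ijn] := ltnP (i + j) n; first by rewrite fn ?mul0r.
by rewrite (inm_monomial u1 v1) ?mulr0 //; apply: leq_trans ijn.
Qed.

Lemma subs_mon c a b u v : inm 1 u -> inm 1 v ->
  subs (const c * mon a b) u v = const c * (u ^+ a * v ^+ b).
Proof.
move=> u1 v1; apply: co_inj => m n; rewrite co_constM /subs co_mk.
set w := co (u ^+ a * v ^+ b) m n.
transitivity (\sum_(i < (m + n).+1) \sum_(j < (m + n).+1)
    if (i == a :> nat) && (j == b :> nat) then c * w else 0).
  apply: eq_bigr => i _; apply: eq_bigr => j _.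
  rewrite co_constM co_mon; case: eqP => [->|] /=; last by rewrite mulr0 mul0r.
  by case: eqP => [->|] /=; rewrite ?mulr1 // mulr0 mul0r.
rewrite (sum_delta2 _ a b (fun _ _ => c * w)); case: ifP => // abmn.
suff -> : w = 0 by rewrite mulr0.
by apply: (inm_monomial u1 v1); move: abmn; lia.
Qed.

Lemma subs_const c u v : inm 1 u -> inm 1 v -> subs (const c) u v = const c.
Proof.
by move=> u1 v1; have := subs_mon c 0 0 u1 v1; rewrite /mon !expr0 !mulr1.
Qed.

Lemma subs_x u v : inm 1 u -> inm 1 v -> subs X u v = u.
Proof.
by move=> u1 v1; have := subs_mon 1 1 0 u1 v1; rewrite /mon !expr0 !mulr1 const1 !mul1r.
Qed.

Lemma subs_y u v : inm 1 u -> inm 1 v -> subs Y u v = v.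
Proof.
by move=> u1 v1; have := subs_mon 1 0 1 u1 v1; rewrite /mon !expr0 const1 !mul1r.
Qed.

(** By additivity and continuity in each factor separately, the identity reduces to products of
    monomials. *)
Lemma subsM f g u v : inm 1 u -> inm 1 v ->
  subs (f * g) u v = subs f u v * subs g u v.
Proof.
move=> u1 v1; set e := (fun f => subs f u v).
apply: (@cont_eq (fun f => e (f * g)) (fun f => e f * e g) 0) => [a b|a b|n a an|n a an|c a b].
- by rewrite mulrDl /e subsD.
- by rewrite /e subsD mulrDl.
- by apply: inm_subs => //; apply: inmMr; rewrite addn0 in an.
- by apply: inmMr; apply: inm_subs => //; rewrite addn0 in an.
set p := const c * mon a b.
apply: (@cont_eq (fun g => e (p * g)) (fun g => e p * e g) 0) => [k l|k l|n k kn|n k kn|d k l].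
- by rewrite mulrDr /e subsD.
- by rewrite /e subsD mulrDr.
- by apply: inm_subs => //; apply: inmMl; rewrite addn0 in kn.
- by apply: inmMl; apply: inm_subs => //; rewrite addn0 in kn.
rewrite /e /p !subs_mon // mulrACA -constM.
have -> : mon a b * mon k l = mon (a + k) (b + l).
  by rewrite /mon !exprD; ring.
by rewrite subs_mon // !exprD constM; ring.
Qed.

Lemma subs_0 u v : inm 1 u -> inm 1 v -> subs 0 u v = 0.
Proof. by move=> u1 v1; rewrite -const0 subs_const. Qed.

Lemma subs_1 u v : inm 1 u -> inm 1 v -> subs 1 u v = 1.
Proof. by move=> u1 v1; rewrite -const1 subs_const. Qed.

Lemma subsN f u v : inm 1 u -> inm 1 v -> subs (- f) u v = - subs f u v.
Proof.
by move=> u1 v1; apply/eqP; rewrite -addr_eq0 -subsD addNr subs_0.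
Qed.

Lemma subsB f g u v : inm 1 u -> inm 1 v ->
  subs (f - g) u v = subs f u v - subs g u v.
Proof. by move=> u1 v1; rewrite subsD subsN. Qed.

Lemma subsX f k u v : inm 1 u -> inm 1 v ->
  subs (f ^+ k) u v = subs f u v ^+ k.
Proof.
move=> u1 v1; elim: k => [|k IHk]; first by rewrite !expr0 subs_1.
by rewrite !exprS subsM // IHk.
Qed.

Lemma subs_sum (I : Type) (r : seq I) (F : I -> S) u v : inm 1 u -> inm 1 v ->
  subs (\sum_(k <- r) F k) u v = \sum_(k <- r) subs (F k) u v.
Proof.
move=> u1 v1.
apply: (big_morph (fun f => subs f u v)) => [f g|]; first exact: subsD.
exact: subs_0.
Qed.

Lemma subs_comp f u v u' v' : inm 1 u -> inm 1 v -> inm 1 u' -> inm 1 v' ->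
  subs (subs f u v) u' v' = subs f (subs u u' v') (subs v u' v').
Proof.
move=> u1 v1 u1' v1'.
have u1'' : inm 1 (subs u u' v') by apply: inm_subs.
have v1'' : inm 1 (subs v u' v') by apply: inm_subs.
apply: (@cont_eq (fun f => subs (subs f u v) u' v')
  (fun f => subs f (subs u u' v') (subs v u' v')) 0)
  => [a b|a b|n a|n a|c a b].
- by rewrite !subsD.
- by rewrite !subsD.
- by rewrite addn0 => an; do 2 apply: inm_subs => //.
- by rewrite addn0 => an; apply: inm_subs.
by rewrite !subs_mon // !subsM // !subsX // subs_const.
Qed.

Lemma subs_id f : subs f X Y = f.
Proof.
apply: (@cont_eq (fun f => subs f X Y) id 0) => [a b|a b|n a|n a|c a b] //.
- by rewrite !subsD.
- by rewrite addn0 => an; apply: inm_subs => //; [apply: inmX1 | apply: inmY1].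
- by rewrite addn0.
by rewrite subs_mon //; [apply: inmX1 | apply: inmY1].
Qed.

Lemma co00_subs f u v : co (subs f u v) 0%N 0%N = co f 0%N 0%N.
Proof. by rewrite /subs co_mk !big_ord1 !expr0 mulr1 co1 mulr1. Qed.

Lemma co_subs_linear f u v i j : inm 1 u -> inm 1 v -> (i + j = 1)%N ->
  co (subs f u v) i j = co f 1%N 0%N * co u i j + co f 0%N 1%N * co v i j.
Proof.
move=> u1 v1 ij.
have uv : co (u * v) i j = 0 by apply: (inmM u1 v1); rewrite ij.
rewrite /subs co_mk ij !big_ord_recl !big_ord0 /= !expr0 !expr1 !mulr1 !mul1r uv.
rewrite co1 mulr0 !addr0.
have -> : (i == 0%N) && (j == 0%N) = false by lia.
by rewrite mulr0 add0r addrC.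
Qed.

End Formal.

Arguments const {K S}.
Arguments X {K S}.
Arguments Y {K S}.

(** * Derivations and partial derivatives *)

Section Derivations.
Variables (K : numFieldType) (S : series K).
Implicit Types (f g h u v : S) (c : K) (n : nat).

Lemma mulX_eq0 f : X * f = 0 -> f = 0.
Proof. by move=> Xf; apply: co_inj => i j; rewrite -[LHS](co_XM f i.+1) Xf !co0. Qed.

Lemma mulY_eq0 f : Y * f = 0 -> f = 0.
Proof. by move=> Yf; apply: co_inj => i j; rewrite -[LHS](co_YM f i j.+1) Yf !co0. Qed.

(** Serves the chain rule, with [e] a substitution, and the expression of a vector field in its
    components, with [e] the identity. The Leibniz rule propagates the equality from [X] and [Y] to
    monomials, continuity to all series. *)
Lemma twisted_deriv_eq (e D1 D2 : S -> S) d :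
    e 1 = 1 ->
    (forall f g, D1 (f + g) = D1 f + D1 g) -> (forall f g, D2 (f + g) = D2 f + D2 g) ->
    (forall c f, D1 (const c * f) = const c * D1 f) ->
    (forall c f, D2 (const c * f) = const c * D2 f) ->
    (forall f g, D1 (f * g) = D1 f * e g + e f * D1 g) ->
    (forall f g, D2 (f * g) = D2 f * e g + e f * D2 g) ->
    (forall n f, inm (n + d) f -> inm n (D1 f)) ->
    (forall n f, inm (n + d) f -> inm n (D2 f)) ->
    D1 X = D2 X -> D1 Y = D2 Y ->
  forall f, D1 f = D2 f.
Proof.
move=> e1 A1 A2 Z1 Z2 L1 L2 C1 C2 DX DY.
have L11 D : (forall f g, D (f * g) = D f * e g + e f * D g) -> D 1 = 0.
  by move=> L; apply: (addIr (D 1)); rewrite add0r -{3}[1]mulr1 L e1 mulr1 mul1r.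
have pow f k : D1 f = D2 f -> D1 (f ^+ k) = D2 (f ^+ k).
  move=> Df; elim: k => [|k IHk]; first by rewrite !expr0 !L11.
  by rewrite exprS L1 L2 Df IHk.
by apply: (cont_eq A1 A2 C1 C2) => c a b; rewrite Z1 Z2 /mon L1 L2 !pow.
Qed.

Definition dx f : S := mk S (fun i j => co f i.+1 j *+ i.+1).
Definition dy f : S := mk S (fun i j => co f i j.+1 *+ j.+1).
(** Primitive in y with value 0 on y = 0; the divisor is the new exponent [j], which is never 0. *)
Definition iy f : S := mk S (fun i j => if j is j'.+1 then co f i j' / j%:R else 0).

Lemma dxD f g : dx (f + g) = dx f + dx g.
Proof. by apply: co_inj => i j; rewrite coD !co_mk coD mulrnDl. Qed.

Lemma dyD f g : dy (f + g) = dy f + dy g.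
Proof. by apply: co_inj => i j; rewrite coD !co_mk coD mulrnDl. Qed.

Lemma dx_const c f : dx (const c * f) = const c * dx f.
Proof. by apply: co_inj => i j; rewrite co_constM !co_mk co_constM mulrnAr. Qed.

Lemma dy_const c f : dy (const c * f) = const c * dy f.
Proof. by apply: co_inj => i j; rewrite co_constM !co_mk co_constM mulrnAr. Qed.

Lemma dx0 : dx 0 = 0.
Proof. by apply: (addIr (dx 0)); rewrite -dxD !add0r. Qed.

Lemma dy0 : dy 0 = 0.
Proof. by apply: (addIr (dy 0)); rewrite -dyD !add0r. Qed.

Lemma dx1 : dx 1 = 0.
Proof. by apply: co_inj => i j; rewrite co_mk co0 co1 mul0rn. Qed.

Lemma dy1 : dy 1 = 0.
Proof. by apply: co_inj => i j; rewrite co_mk co0 co1 andbF mul0rn. Qed.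

Lemma dxB f g : dx (f - g) = dx f - dx g.
Proof. by apply/eqP; rewrite -(inj_eq (addIr (dx g))) -dxD !subrK. Qed.

Lemma dyB f g : dy (f - g) = dy f - dy g.
Proof. by apply/eqP; rewrite -(inj_eq (addIr (dy g))) -dyD !subrK. Qed.

Lemma inm_dx n f : inm n.+1 f -> inm n (dx f).
Proof. by move=> fn i j ij; rewrite co_mk fn ?mul0rn. Qed.

Lemma inm_dy n f : inm n.+1 f -> inm n (dy f).
Proof. by move=> fn i j ij; rewrite co_mk fn ?mul0rn // addnS. Qed.

Lemma inm_iy n f : inm n f -> inm n.+1 (iy f).
Proof.
move=> fn i [|j] ij; rewrite co_mk // fn ?mul0r //.
by move: ij; rewrite addnS.
Qed.

(** The series [f] for which the rule holds against every [g] are closed under products, so [X] and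
    [Y] suffice by continuity. *)
Lemma leibniz_ext (D : S -> S) :
    (forall f g, D (f + g) = D f + D g) ->
    (forall c f, D (const c * f) = const c * D f) ->
    (forall n f, inm n.+1 f -> inm n (D f)) ->
    (forall g, D (X * g) = D X * g + X * D g) ->
    (forall g, D (Y * g) = D Y * g + Y * D g) ->
  forall f g, D (f * g) = D f * g + f * D g.
Proof.
move=> A Z Ct LX LY f g.
pose L f := forall g, D (f * g) = D f * g + f * D g.
have LM h k : L h -> L k -> L (h * k).
  by move=> Lh Lk l; rewrite -mulrA Lh Lk Lh; ring.
have D1 : D 1 = 0.
  by apply: mulX_eq0; have := LX 1; rewrite !mulr1 -{1}[D X]addr0 => /addrI.
have L1 : L 1 by move=> l; rewrite D1 !mul1r mul0r add0r.
have pow h k : L h -> L (h ^+ k).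
  by move=> Lh; elim: k => [|k IHk]; rewrite ?expr0 // exprS; apply: LM.
apply: (@cont_eq _ _ (fun f => D (f * g)) (fun f => D f * g + f * D g) 1) => [a b|a b|n a|n a|c a b].
- by rewrite mulrDl A.
- by rewrite A; ring.
- by rewrite addn1 => an; apply/Ct/inmMr.
- rewrite addn1 => an; apply: inmD; first by apply/inmMr/Ct.
  by apply/inmMr/(inm_leq (leqnSn _)).
have Lm : L (mon S a b) := LM _ _ (pow X a LX) (pow Y b LY).
by rewrite -mulrA !Z Lm; ring.
Qed.

Lemma dxX : dx X = 1.
Proof.
apply: co_inj => i j; rewrite !co_mk co1 eqSS; case: i => [|i] //=.
by rewrite mul0rn.
Qed.

Lemma dxY : dx Y = 0.
Proof. by apply: co_inj => i j; rewrite !co_mk co0 /= mul0rn. Qed.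

Lemma dyX : dy X = 0.
Proof. by apply: co_inj => i j; rewrite !co_mk co0 andbF mul0rn. Qed.

Lemma dyY : dy Y = 1.
Proof.
apply: co_inj => i j; rewrite !co_mk co1 eqSS; case: j => [|j] //=.
by rewrite andbF mul0rn.
Qed.

Lemma dxM f g : dx (f * g) = dx f * g + f * dx g.
Proof.
apply: leibniz_ext => [||n k||] {f g}; [exact: dxD|exact: dx_const|exact: inm_dx| |].
  move=> g; rewrite dxX mul1r; apply: co_inj => i j; rewrite coD co_XM !co_mk co_XM.
  by case: i => [|i]; rewrite ?addr0 // co_mk mulrS.
move=> g; rewrite dxY mul0r add0r; apply: co_inj => i j; rewrite co_YM co_mk co_YM.
by case: j => [|j]; rewrite ?mul0rn // co_mk.
Qed.

Lemma dyM f g : dy (f * g) = dy f * g + f * dy g.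
Proof.
apply: leibniz_ext => [||n k||] {f g}; [exact: dyD|exact: dy_const|exact: inm_dy| |].
  move=> g; rewrite dyX mul0r add0r; apply: co_inj => i j; rewrite co_XM co_mk co_XM.
  by case: i => [|i]; rewrite ?mul0rn // co_mk.
move=> g; rewrite dyY mul1r; apply: co_inj => i j; rewrite coD co_YM !co_mk co_YM.
by case: j => [|j]; rewrite ?addr0 // co_mk mulrS.
Qed.

(** Continuity comes for free: write [f] as X f1 + Y f2 with f1 and f2 of one order less, and apply
    the Leibniz rule inductively. *)
Lemma deriv_inm (D : S -> S) :
    (forall f g, D (f + g) = D f + D g) ->
    (forall f g, D (f * g) = D f * g + f * D g) ->
  forall n f, inm n.+1 f -> inm n (D f).
Proof.
move=> A L; elim=> [|n IHn] f fn; first exact: inm0.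
rewrite (inm_split fn) A !L.
have dX := inm_divx fn; have dY := inm_divy (inm_at_x0 fn).
apply: inmD; apply: inmD.
- exact: inmMl.
- by apply: (@inmM _ _ 1 n); [exact: inmX1 | exact: IHn].
- exact: inmMl.
- by apply: (@inmM _ _ 1 n); [exact: inmY1 | exact: IHn].
Qed.

Lemma derivE (D : S -> S) :
    (forall f g, D (f + g) = D f + D g) ->
    (forall c f, D (const c * f) = const c * D f) ->
    (forall f g, D (f * g) = D f * g + f * D g) ->
  forall f, D f = D X * dx f + D Y * dy f.
Proof.
move=> A Z L; apply: (@twisted_deriv_eq id _ _ 1) => // [f g|c f|f g|n f|n f||].
- by rewrite dxD dyD; ring.
- by rewrite dx_const dy_const; ring.
- by rewrite dxM dyM; ring.
- by rewrite addn1; apply: deriv_inm.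
- by rewrite addn1 => fn; apply: inmD; apply: inmMl; [apply: inm_dx|apply: inm_dy].
- by rewrite dxX dyX; ring.
- by rewrite dxY dyY; ring.
Qed.

Lemma dx_subs f u v : inm 1 u -> inm 1 v ->
  dx (subs f u v) = subs (dx f) u v * dx u + subs (dy f) u v * dx v.
Proof.
move=> u1 v1.
apply: (@twisted_deriv_eq (fun f => subs f u v) (fun f => dx (subs f u v))
  (fun f => subs (dx f) u v * dx u + subs (dy f) u v * dx v) 1)
  => [|a b|a b|c a|c a|a b|a b|n a|n a||].
- exact: subs_1.
- by rewrite subsD dxD.
- by rewrite dxD dyD !subsD; ring.
- by rewrite subsM // subs_const // dx_const.
- by rewrite dx_const dy_const !subsM // !subs_const //; ring.
- by rewrite subsM // dxM.
- by rewrite dxM dyM !subsD !subsM //; ring.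
- by rewrite addn1 => an; apply/inm_dx/inm_subs.
- by rewrite addn1 => an; apply: inmD; apply/inmMr/inm_subs => //; [apply: inm_dx|apply: inm_dy].
- by rewrite subs_x // dxX dyX subs_1 // subs_0 //; ring.
- by rewrite subs_y // dxY dyY subs_1 // subs_0 //; ring.
Qed.

Lemma dy_subs f u v : inm 1 u -> inm 1 v ->
  dy (subs f u v) = subs (dx f) u v * dy u + subs (dy f) u v * dy v.
Proof.
move=> u1 v1.
apply: (@twisted_deriv_eq (fun f => subs f u v) (fun f => dy (subs f u v))
  (fun f => subs (dx f) u v * dy u + subs (dy f) u v * dy v) 1)
  => [|a b|a b|c a|c a|a b|a b|n a|n a||].
- exact: subs_1.
- by rewrite subsD dyD.
- by rewrite dxD dyD !subsD; ring.
- by rewrite subsM // subs_const // dy_const.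
- by rewrite dx_const dy_const !subsM // !subs_const //; ring.
- by rewrite subsM // dyM.
- by rewrite dxM dyM !subsD !subsM //; ring.
- by rewrite addn1 => an; apply/inm_dy/inm_subs.
- by rewrite addn1 => an; apply: inmD; apply/inmMr/inm_subs => //; [apply: inm_dx|apply: inm_dy].
- by rewrite subs_x // dxX dyX subs_1 // subs_0 //; ring.
- by rewrite subs_y // dxY dyY subs_1 // subs_0 //; ring.
Qed.

Lemma dy_iy f : dy (iy f) = f.
Proof.
apply: co_inj => i j; rewrite !co_mk /=.
by rewrite -[LHS]mulr_natr divfK // pnatr_eq0.
Qed.

Lemma iyD f g : iy (f + g) = iy f + iy g.
Proof.
apply: co_inj => i [|j]; rewrite coD !co_mk /= ?addr0 //.
by rewrite coD mulrDl.
Qed.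

Lemma iyB f g : iy (f - g) = iy f - iy g.
Proof. by apply/eqP; rewrite -(inj_eq (addIr (iy g))) -iyD !subrK. Qed.

Lemma iy_dy f : iy (dy f) = f - at_y0 f.
Proof.
apply: co_inj => i [|j]; rewrite coB !co_mk /= ?subrr // subr0 ?co_mk.
by rewrite -[X in X / _]mulr_natr mulfK // pnatr_eq0.
Qed.

Lemma at_y0E f : at_y0 f = subs f X 0.
Proof.
apply: (@cont_eq _ _ (fun f => at_y0 f) (fun f => subs f X 0) 0) => [a b|a b|n a|n a|c a b] {f}.
- by apply: co_inj => i j; rewrite coD !co_mk coD; case: ifP; rewrite ?addr0.
- by rewrite subsD.
- by rewrite addn0 => an i j ij; rewrite co_mk; case: ifP => // _; apply: an.
- by rewrite addn0; apply: inm_subs; [exact: inmX1 | exact: inm_zero].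
rewrite subs_mon; [|exact: inmX1 | exact: inm_zero].
apply: co_inj => i j; rewrite co_mk !co_constM co_mon.
case: b => [|b].
  by rewrite expr0 mulr1 -[X ^+ a]mulr1 co_XnM co1 subn_eq0; case: (j == 0%N) => /=;
    rewrite ?andbT ?andbF ?if_same ?mulr0 // eqn_leq; case: ltngtP; rewrite ?mulr0.
rewrite expr0n /= mulr0 co0 mulr0; case: j => [|j] //=.
by rewrite andbF mulr0.
Qed.

End Derivations.

(** * Fixed points of contractions for the Krull topology *)

Section FixedPoints.
Variables (K : numClosedFieldType) (S : series K).
Implicit Types (f g h u v : S) (c : K) (n : nat).

Lemma mod_refl n f : inm n (f - f).
Proof. by rewrite subrr; apply: inm_zero. Qed.

Lemma modD n f f' g g' : inm n (f - f') -> inm n (g - g') -> inm n (f + g - (f' + g')).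
Proof.
by move=> ff gg; rewrite (_ : _ - _ = f - f' + (g - g')); [exact: inmD | ring].
Qed.

Lemma modN n f f' : inm n (f - f') -> inm n (- f - - f').
Proof. by move=> ff; rewrite -opprD; apply: inmN. Qed.

Lemma modM1 n f f' g g' : inm 1 g -> inm 1 f' ->
  inm n (f - f') -> inm n (g - g') -> inm n.+1 (f * g - f' * g').
Proof.
move=> g1 f1 ff gg; rewrite (_ : _ - _ = (f - f') * g + f' * (g - g')); last by ring.
by apply: inmD; [rewrite -addn1 | rewrite -add1n]; apply: inmM.
Qed.

Lemma modMl n f g g' : inm 1 f -> inm n (g - g') -> inm n.+1 (f * g - f * g').
Proof. by move=> f1 gg; rewrite -mulrBr -add1n; apply: inmM. Qed.

Lemma inm_const0 f : inm 1 (f - const (co f 0%N 0%N)).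
Proof. by apply/inm1P; rewrite coB co_const subrr. Qed.

Lemma inm_linear0 f :
  inm 2 (f - (const (co f 0%N 0%N) + const (co f 1%N 0%N) * X + const (co f 0%N 1%N) * Y)).
Proof.
move=> i j; rewrite !coB !coD co_const !co_constM /X /Y !co_mk.
by case: i => [|[|i]]; case: j => [|[|j]] //= _; ring.
Qed.

Lemma mod_subs n f u v u' v' : inm 1 u -> inm 1 v -> inm 1 u' -> inm 1 v' ->
  inm n (u - u') -> inm n (v - v') -> inm n (subs f u v - subs f u' v').
Proof.
move=> u1 v1 u1' v1'; elim: n f => [|n IHn] f uu vv; first exact: inm0.
have [un vn] : inm n (u - u') /\ inm n (v - v') by split; apply: inm_leq (leqnSn n) _.
have -> : f = const (co f 0%N 0%N) + (f - const (co f 0%N 0%N)) by ring.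
rewrite (inm_split (inm_const0 f)); set f1 := divx _; set f2 := divy _.
rewrite !subsD !subsM // !subs_x // !subs_y // !subs_const //.
apply: modD; first exact: mod_refl.
apply: modD.
  rewrite (_ : _ - _ = (u - u') * subs f1 u v + u' * (subs f1 u v - subs f1 u' v')); last by ring.
  by apply: inmD; [apply: inmMr | apply: (@inmM _ _ 1) => //; apply: IHn].
rewrite (_ : _ - _ = (v - v') * subs f2 u v + v' * (subs f2 u v - subs f2 u' v')); last by ring.
by apply: inmD; [apply: inmMr | apply: (@inmM _ _ 1) => //; apply: IHn].
Qed.

(** Here [f] is X f1 + Y f2 with f1 and f2 vanishing at 0, so each product gains one order. This
    makes terms of order 2 contractions in the fixed point arguments. *)
Lemma mod_subs1 n f u v u' v' : inm 1 u -> inm 1 v -> inm 1 u' -> inm 1 v' ->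
  inm 2 f -> inm n (u - u') -> inm n (v - v') -> inm n.+1 (subs f u v - subs f u' v').
Proof.
move=> u1 v1 u1' v1' f2 uu vv; rewrite (inm_split f2).
have dX := inm_divx f2; have dY := inm_divy (inm_at_x0 f2).
rewrite !subsD !subsM // !subs_x // !subs_y //.
by apply: modD; apply: modM1 => //; do ?[exact: inm_subs | exact: mod_subs].
Qed.

Lemma fixpoint_exists e (Phi : S -> S) :
    (forall z, inm e z -> inm e (Phi z)) ->
    (forall n z w, inm e z -> inm e w -> inm n (z - w) -> inm n.+1 (Phi z - Phi w)) ->
  exists2 z, inm e z & z = Phi z.
Proof.
move=> Pe Pc; pose a k := iter k Phi 0.
have ae k : inm e (a k) by elim: k => [|k IHk]; [exact: inm_zero | apply: Pe].
have step k : inm k (a k.+1 - a k).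
  by elim: k => [|k IHk]; [exact: inm0 | exact: (Pc _ _ _ (ae k.+1) (ae k) IHk)].
have far k l : inm k (a (k + l)%N - a k).
  elim: l => [|l IHl]; first by rewrite addn0; apply: mod_refl.
  rewrite addnS (_ : _ - _ = a (k + l).+1 - a (k + l)%N + (a (k + l)%N - a k)); last by ring.
  by apply: inmD => //; apply: inm_leq (step _); rewrite leq_addr.
(* The coefficients of total degree i + j no longer change from the iterate of rank i + j + 1 on. *)
pose z : S := mk S (fun i j => co (a (i + j).+1) i j).
have za k : inm k (z - a k).
  move=> i j ijk; rewrite coB co_mk; apply/eqP; rewrite subr_eq0 eq_sym -subr_eq0 -coB.
  by rewrite -(subnKC ijk) (far (i + j).+1 (k - (i + j).+1)%N).
have ze : inm e z.
  by move=> i j ije; rewrite co_mk (ae _ _ _ ije).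
exists z => //; apply/eqP; rewrite -subr_eq0; apply/eqP/inm_eq0 => n.
rewrite (_ : _ - _ = z - a n.+1 + (Phi (a n) - Phi z)); last by rewrite /a /=; ring.
apply: inmD; first by apply: inm_leq (za _).
apply: inm_leq (leqnSn n) _; apply: Pc => //.
by rewrite -opprB; apply/inmN/za.
Qed.

Lemma fixpoint_unique e (Phi : S -> S) z w :
    (forall n z w, inm e z -> inm e w -> inm n (z - w) -> inm n.+1 (Phi z - Phi w)) ->
  inm e z -> inm e w -> z = Phi z -> w = Phi w -> z = w.
Proof.
move=> Pc ze we zP wP; apply/eqP; rewrite -subr_eq0; apply/eqP/inm_eq0.
by elim=> [|n IHn]; [exact: inm0 | rewrite zP wP; apply: Pc].
Qed.

(** The linear part of [g] isolates u - u' up to a nonzero factor and the remainder of order 2 is a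
    contraction, so the order of u - u' grows without bound. *)
Lemma subs_inj1 g u u' v : co g 1%N 0%N != 0 -> inm 1 u -> inm 1 u' -> inm 1 v ->
  subs g u v = subs g u' v -> u = u'.
Proof.
move=> g10 u1 u1' v1 guu; apply/eqP; rewrite -subr_eq0; apply/eqP/inm_eq0.
have [g2 g2m gE] : exists2 g2, inm 2 g2 & g = const (co g 0%N 0%N) +
    const (co g 1%N 0%N) * X + const (co g 0%N 1%N) * Y + g2.
  by exists (g - (const (co g 0%N 0%N) + const (co g 1%N 0%N) * X + const (co g 0%N 1%N) * Y));
    [exact: inm_linear0 | ring].
elim=> [|n IHn]; first exact: inm0.
have : inm n.+1 (subs g2 u v - subs g2 u' v) by apply: mod_subs1 => //; apply: mod_refl.
move: guu; rewrite {1 2}gE !subsD !subsM // !subs_x // !subs_y // !subs_const // => guu g2n.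
have -> : u - u' = const (co g 1%N 0%N)^-1 * (const (co g 1%N 0%N) * (u - u')).
  by rewrite mulrA -constM mulVf // const1 mul1r.
apply: inmMl; rewrite (_ : _ * _ = - (subs g2 u v - subs g2 u' v)); first exact: inmN.
by apply/eqP; rewrite -subr_eq0; move/eqP: guu; rewrite -subr_eq0 => /eqP <-; apply/eqP; ring.
Qed.

Lemma inverse_exists f : co f 0%N 0%N != 0 -> exists g, f * g = 1.
Proof.
move=> f0; set c := co f 0%N 0%N in f0.
pose b := const c^-1 * f - 1.
have b1 : inm 1 b.
  by apply/inm1P; rewrite /b coB co_constM co1 mulVf // subrr.
(* With f = c (1 + b), the inverse is c^-1 (1 + z) where (1 + b) (1 + z) = 1. *)
have [||z _ zE] := @fixpoint_exists 1 (fun z => - b - b * z).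
- by move=> z z1; apply: inmB; [apply: inmN | apply: inmMr].
- move=> n z w _ _ zw; apply: modD; first exact: mod_refl.
  by apply: modN; apply: modMl.
exists (const c^-1 * (1 + z)).
have -> : f * (const c^-1 * (1 + z)) = (1 + b) * (1 + z) by rewrite /b; ring.
by rewrite (_ : _ * _ = 1 + (z - (- b - b * z))); [rewrite -zE subrr addr0 | ring].
Qed.

Lemma mulr_cancel f g : co f 0%N 0%N != 0 -> f * g = 0 -> g = 0.
Proof.
by move=> /inverse_exists[h fh] fg; rewrite -[g]mul1r -fh mulrAC fg mul0r.
Qed.

Lemma root_exists f k : (0 < k)%N -> co f 0%N 0%N != 0 -> exists g, g ^+ k = f.
Proof.
move=> k0 f0; set c := co f 0%N 0%N in f0.
pose b := const c^-1 * f - 1.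
have b1 : inm 1 b.
  by apply/inm1P; rewrite /b coB co_constM co1 mulVf // subrr.
have kK : k%:R != 0 :> K by rewrite pnatr_eq0 -lt0n.
have [q q2 qE] : exists2 q : S, inm 2 q & (1 + X) ^+ k = 1 + const k%:R * X + q.
  elim: k {k0 kK} => [|k [q q2 IHk]].
    by exists 0; [exact: inm_zero | rewrite const0; ring].
  exists (q + X * q + const k%:R * X ^+ 2).
    apply: inmD; last by apply/inmMl/inmX/inmX1.
    by apply: inmD => //; apply: inmMl.
  by rewrite exprS IHk -addn1 natrD constD const1; ring.
(* The equation k z + q(z, 0) = b says (1 + z)^k = 1 + b = f / c; a k-th root of c exists since [K]
   is algebraically closed. *)
have [||z z1 zE] := @fixpoint_exists 1 (fun z => const k%:R^-1 * (b - subs q z 0)).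
- move=> z z1; apply: inmMl; apply: inmB => //.
  by apply: inm_subs => //; [exact: inm_zero | apply: inm_leq q2].
- move=> n z w z1 w1 zw; rewrite -mulrBr; apply: inmMl; apply: modD; first exact: mod_refl.
  by apply: modN; apply: mod_subs1 => //; try exact: inm_zero; apply: mod_refl.
exists (const (k.-root c) * (1 + z)).
rewrite exprMn.
have -> : const (k.-root c) ^+ k = const c :> S.
  have cX d l : const d ^+ l = const (d ^+ l) :> S.
    by elim: l => [|l IHl]; rewrite ?expr0 ?const1 // !exprS IHl constM.
  by rewrite cX rootCK.
have -> : (1 + z) ^+ k = 1 + const k%:R * z + subs q z 0.
  have Z0 := @inm_zero K S 1.
  have := congr1 (fun f => subs f z 0) qE.
  by rewrite subsX // !subsD subsM // subs_const // subs_x // subs_1.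
have -> : 1 + const k%:R * z + subs q z 0 = 1 + b.
  by rewrite {1}zE mulrA -constM mulfV // const1; ring.
by rewrite /b addrCA subrr addr0 mulrA -constM mulfV // const1 mul1r.
Qed.

(** Integral form of the Cauchy problem dz/dy = s dz/dx with data [r]: [dx] loses an order, the
    factor [s] restores it and [iy] gains one. *)
Lemma pde_contract (s r : S) n z w : inm 1 s -> inm n (z - w) ->
  inm n.+1 (r + iy (s * dx z) - (r + iy (s * dx w))).
Proof.
move=> s1 zw.
apply: modD; first exact: mod_refl.
rewrite -iyB -mulrBr -dxB; apply: inm_iy; case: n zw => [|n] zw; first exact: inm0.
by apply: (@inmM _ _ 1) => //; apply: inm_dx.
Qed.

End FixedPoints.

(** * Convergence *)

(** The target is [R], as for the modulus of [R[i]] used in the definition of convergence. The field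
    [nmMn] makes the absolute value archimedean, so that dividing by a positive integer never
    increases it. *)
Record absval (R : realType) (K : numClosedFieldType) := Absval {
  nm :> K -> R;
  nm_ge0 : forall c, 0 <= nm c;
  nm0 : nm 0 = 0;
  nm1 : nm 1 = 1;
  nmN : forall c, nm (- c) = nm c;
  nmM : forall c d, nm (c * d) = nm c * nm d;
  nmD : forall c d, nm (c + d) <= nm c + nm d;
  nmMn : forall c n, nm (c *+ n) = nm c *+ n }.

Section Norms.
Variables (R : realType) (K : numClosedFieldType) (N : absval R K) (S : series K).
Implicit Types (f g h u v z w : S) (c : K) (n : nat) (r M rho : R).

Lemma sum_triangle n (H : nat -> nat -> R) : (forall k m, 0 <= H k m) ->
  \sum_(i < n) \sum_(k < i.+1) H k (i - k)%N <= \sum_(k < n) \sum_(m < n) H k m.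
Proof.
move=> H0.
have -> : \sum_(i < n) \sum_(k < i.+1) H k (i - k)%N =
          \sum_(i < n) \sum_(k < n) if (k <= i)%N then H k (i - k)%N else 0.
  apply: eq_bigr => i _.
  by rewrite (big_ord_widen n (fun k => H k (i - k)%N) (ltn_ord i)) big_mkcond.
rewrite exchange_big /=; apply: ler_sum => k _.
rewrite -big_mkcond /= -(big_mkord (fun i => (k <= i)%N) (fun i => H k (i - k)%N)).
rewrite -(big_mkord xpredT (fun i => H k i)).
have kn : (k <= n)%N by apply: ltnW.
rewrite (big_cat_nat _ (n := k)) //= big_nat_cond big1 ?add0r; last first.
  by move=> i /andP[/andP[_ ik]]; rewrite leqNgt ik.
rewrite -{1}[k : nat]add0n big_addn [leRHS](big_cat_nat _ (n := (n - k)%N)) ?leq_subr //=.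
apply: ler_wpDr; first exact: sumr_ge0.
rewrite big_mkcond /=; apply: ler_sum => i _; rewrite addnK.
by case: ifP.
Qed.

(** Partial sums, over squares, of the l1 norm with weight [r]. This norm is submultiplicative, and
    a common bound on the partial sums replaces summability. *)
Definition psum r f n : R := \sum_(i < n) \sum_(j < n) N (co f i j) * r ^+ (i + j).

Definition bnd r M f := forall n, psum r f n <= M.

Definition convergent f := exists2 r, 0 < r & exists M, bnd r M f.

Lemma psum_ge0 r f n : 0 <= r -> 0 <= psum r f n.
Proof.
move=> r0; apply: sumr_ge0 => i _; apply: sumr_ge0 => j _.
by rewrite mulr_ge0 ?nm_ge0 ?exprn_ge0.
Qed.

Lemma psum_le r f g n : 0 <= r ->
  (forall i j, N (co g i j) <= N (co f i j)) -> psum r g n <= psum r f n.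
Proof.
move=> r0 gf; apply: ler_sum => i _; apply: ler_sum => j _.
by rewrite ler_wpM2r ?exprn_ge0.
Qed.

Lemma bnd_ge0 r M f : bnd r M f -> 0 <= M.
Proof. by move/(_ 0%N); rewrite /psum big_ord0. Qed.

Lemma bnd_leM r M M' f : M <= M' -> bnd r M f -> bnd r M' f.
Proof. by move=> MM fM n; apply: le_trans (fM n) MM. Qed.

Lemma bnd_le r M f g : 0 <= r ->
  (forall i j, N (co g i j) <= N (co f i j)) -> bnd r M f -> bnd r M g.
Proof. by move=> r0 gf fM n; apply: le_trans (psum_le n r0 gf) (fM n). Qed.

Lemma bndD r M M' f g : 0 <= r -> bnd r M f -> bnd r M' g -> bnd r (M + M') (f + g).
Proof.
move=> r0 fM gM n; apply: le_trans (lerD (fM n) (gM n)).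
rewrite -big_split; apply: ler_sum => i _; rewrite -big_split; apply: ler_sum => j _ /=.
by rewrite -mulrDl ler_wpM2r ?exprn_ge0 // coD nmD.
Qed.

Lemma bndN r M f : 0 <= r -> bnd r M f -> bnd r M (- f).
Proof. by move=> r0; apply: bnd_le => // i j; rewrite coN nmN. Qed.

Lemma nm_sum (I : Type) (s : seq I) (F : I -> K) :
  N (\sum_(k <- s) F k) <= \sum_(k <- s) N (F k).
Proof.
elim: s => [|k s IHs]; first by rewrite !big_nil nm0.
by rewrite !big_cons; apply: le_trans (nmD _ _ _) _; rewrite lerD2l.
Qed.

Lemma bndM r M M' f g : 0 <= r -> bnd r M f -> bnd r M' g -> bnd r (M * M') (f * g).
Proof.
move=> r0 fM gM n.
pose t h i j := N (co h i j) * r ^+ (i + j).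
have t0 h i j : 0 <= t h i j by rewrite mulr_ge0 ?nm_ge0 ?exprn_ge0.
apply: (le_trans (y := psum r f n * psum r g n)); last first.
  by apply: ler_pM; rewrite ?psum_ge0.
apply: (le_trans (y := \sum_(i < n) \sum_(k < i.+1) \sum_(j < n) \sum_(l < j.+1)
    t f k l * t g (i - k)%N (j - l)%N)).
  apply: ler_sum => i _; rewrite exchange_big /=; apply: ler_sum => j _.
  rewrite coM; apply: (le_trans (y := (\sum_(k < i.+1) \sum_(l < j.+1)
    N (co f k l * co g (i - k)%N (j - l)%N)) * r ^+ (i + j))).
    rewrite ler_wpM2r ?exprn_ge0 //; apply: le_trans (nm_sum _ _) _.
    by apply: ler_sum => k _; apply: nm_sum.
  rewrite mulr_suml; apply: ler_sum => k _; rewrite mulr_suml; apply: ler_sum => l _.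
  rewrite nmM /t mulrACA -exprD le_eqVlt; apply/orP; left; apply/eqP.
  congr (_ * r ^+ _); have := ltn_ord k; have := ltn_ord l; lia.
apply: (le_trans (y := \sum_(k < n) \sum_(m < n) \sum_(j < n) \sum_(l < j.+1)
    t f k l * t g m (j - l)%N)).
  apply: (@sum_triangle n (fun k m => \sum_(j < n) \sum_(l < j.+1) t f k l * t g m (j - l)%N)).
  by move=> k m; apply: sumr_ge0 => j _; apply: sumr_ge0 => l _; rewrite mulr_ge0.
rewrite /psum mulr_suml; apply: ler_sum => k _.
rewrite mulr_sumr; apply: ler_sum => m _.
apply: le_trans (@sum_triangle n (fun l l' => t f k l * t g m l') _) _.
  by move=> l l'; rewrite mulr_ge0.
rewrite mulr_suml; apply: ler_sum => l _; rewrite mulr_sumr; exact: lexx.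
Qed.

Lemma bndX r M f k : 0 <= r -> bnd r M f -> bnd r (M ^+ k) (f ^+ k).
Proof.
move=> r0 fM; elim: k => [|k IHk]; last by rewrite !exprS; apply: bndM.
move=> n; rewrite !expr0 /psum.
case: n => [|n]; first by rewrite big_ord0.
rewrite big_ord_recl [X in _ + X]big1 ?addr0; last first.
  by move=> i _; rewrite big1 // => j _; rewrite co1 nm0 mul0r.
rewrite big_ord_recl [X in _ + X]big1 ?addr0; last first.
  by move=> i _; rewrite co1 nm0 mul0r.
by rewrite co1 nm1 mulr1.
Qed.

Lemma bnd_const r c : 0 <= r -> bnd r (N c) (const c).
Proof.
move=> r0 [|n]; rewrite /psum; first by rewrite big_ord0 nm_ge0.
rewrite big_ord_recl [X in _ + X]big1 ?addr0; last first.
  by move=> i _; rewrite big1 // => j _; rewrite co_const nm0 mul0r.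
rewrite big_ord_recl [X in _ + X]big1 ?addr0; last first.
  by move=> i _; rewrite co_const nm0 mul0r.
by rewrite co_const mulr1.
Qed.

(** A term of degree m >= k scales by (r / r0)^m <= (r / r0)^k when the radius shrinks from [r0] to
    [r]. *)
Lemma bnd_inm k r0 r M f : 0 < r -> r <= r0 -> inm k f ->
  bnd r0 M f -> bnd r ((r / r0) ^+ k * M) f.
Proof.
move=> rp rr fk fM n.
have r0p : 0 < r0 by apply: lt_le_trans rr.
apply: (le_trans (y := (r / r0) ^+ k * psum r0 f n)); last first.
  by rewrite ler_wpM2l // exprn_ge0 // divr_ge0 // ltW.
rewrite /psum mulr_sumr; apply: ler_sum => i _; rewrite mulr_sumr; apply: ler_sum => j _.
have [ij|ij] := ltnP (i + j) k; first by rewrite fk // nm0 !mul0r mulr0.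
rewrite [leRHS]mulrCA ler_wpM2l ?nm_ge0 //; move: (i + j)%N ij => m km.
have -> : (r / r0) ^+ k * r0 ^+ m = r ^+ k * r0 ^+ (m - k).
  by rewrite -{1}(subnKC km) exprD mulrA -exprMn divfK ?gt_eqF.
rewrite -{1}(subnKC km) exprD ler_wpM2l ?exprn_ge0 ?(ltW rp) //.
by apply: lerXn2r; rewrite // nnegrE ltW.
Qed.

Lemma bnd_divx r M f : 0 < r -> bnd r M f -> bnd r (M / r) (divx f).
Proof.
move=> r0 fM n; rewrite ler_pdivlMr //; apply: le_trans (fM n.+1).
rewrite /psum big_ord_recl; apply: ler_wpDl.
  by apply: sumr_ge0 => j _; rewrite mulr_ge0 ?nm_ge0 ?exprn_ge0 // ltW.
rewrite mulr_suml; apply: ler_sum => i _; rewrite big_ord_recr /=; apply: ler_wpDr.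
  by rewrite mulr_ge0 ?nm_ge0 ?exprn_ge0 // ltW.
rewrite mulr_suml; apply: ler_sum => j _.
by rewrite co_mk /bump /= -mulrA -exprSr !add1n.
Qed.

Lemma bnd_divy r M f : 0 < r -> bnd r M f -> bnd r (M / r) (divy f).
Proof.
move=> r0 fM n; rewrite ler_pdivlMr //; apply: le_trans (fM n.+1).
rewrite /psum big_ord_recr; apply: ler_wpDr.
  by apply: sumr_ge0 => j _; rewrite mulr_ge0 ?nm_ge0 ?exprn_ge0 // ltW.
rewrite mulr_suml; apply: ler_sum => i _; rewrite big_ord_recl /=; apply: ler_wpDl.
  by rewrite mulr_ge0 ?nm_ge0 ?exprn_ge0 // ltW.
rewrite mulr_suml; apply: ler_sum => j _.
by rewrite co_mk /bump /= -mulrA -exprSr !add1n addnS.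
Qed.

Lemma bnd_iy r M f : 0 <= r -> bnd r M f -> bnd r (r * M) (iy f).
Proof.
move=> r0 fM n.
apply: (le_trans (y := r * psum r f n)); last by rewrite ler_wpM2l.
rewrite /psum mulr_sumr; apply: ler_sum => i _; case: n i => [|n] i; first by rewrite !big_ord0 mulr0.
rewrite big_ord_recl co_mk nm0 mul0r add0r big_ord_recr /= mulrDr; apply: ler_wpDr.
  by rewrite mulr_ge0 // mulr_ge0 ?nm_ge0 ?exprn_ge0.
rewrite mulr_sumr; apply: ler_sum => j _; rewrite co_mk /bump /= add1n addnS exprS mulrCA.
rewrite ler_wpM2l // ler_wpM2r ?exprn_ge0 //.
have E : co f i j = (co f i j / j.+1%:R) *+ j.+1 by rewrite -[RHS]mulr_natr divfK // pnatr_eq0.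
rewrite {2}E; move: (_ / _) => q.
by rewrite nmMn mulrS lerDl mulrn_wge0 ?nm_ge0.
Qed.

Lemma bnd_subs r r0 M f u v : 0 <= r -> bnd r r0 u -> bnd r r0 v -> bnd r0 M f ->
  bnd r M (subs f u v).
Proof.
move=> rp ur vr fM n.
(* For a, b < n the truncated sum at (a, b) has exponents at most a + b, hence below n + n. *)
apply: le_trans (fM (n + n)%N).
apply: (le_trans (y := \sum_(a < n) \sum_(b < n) \sum_(i < n + n) \sum_(j < n + n)
    N (co f i j) * (N (co (u ^+ i * v ^+ j) a b) * r ^+ (a + b)))).
  apply: ler_sum => a _; apply: ler_sum => b _; rewrite co_mk.
  have abn : ((a + b).+1 <= n + n)%N by have := ltn_ord a; have := ltn_ord b; lia.
  pose t i j := N (co f i j) * (N (co (u ^+ i * v ^+ j) a b) * r ^+ (a + b)).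
  have t0 i j : 0 <= t i j by rewrite !mulr_ge0 ?nm_ge0 ?exprn_ge0.
  have ext (F : nat -> R) : (forall i, 0 <= F i) ->
      \sum_(i < (a + b).+1) F i <= \sum_(i < n + n) F i.
    move=> F0; rewrite -!(big_mkord xpredT) [leRHS](big_cat_nat _ (n := (a + b).+1)) //=.
    by apply: ler_wpDr => //; apply: sumr_ge0.
  apply: (le_trans (y := \sum_(i < (a + b).+1) \sum_(j < (a + b).+1) t i j)).
    apply: (le_trans (y := (\sum_(i < (a + b).+1) \sum_(j < (a + b).+1)
      N (co f i j * co (u ^+ i * v ^+ j) a b)) * r ^+ (a + b))).
      rewrite ler_wpM2r ?exprn_ge0 //; apply: le_trans (nm_sum _ _) _.
      by apply: ler_sum => k _; apply: nm_sum.
    rewrite mulr_suml; apply: ler_sum => i _; rewrite mulr_suml; apply: ler_sum => j _.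
    by rewrite nmM /t mulrA.
  apply: (le_trans (y := \sum_(i < (a + b).+1) \sum_(j < n + n) t i j)).
    by apply: ler_sum => i _; apply: (ext (fun j => t i j)).
  by apply: (ext (fun i => \sum_(j < n + n) t i j)) => i; apply: sumr_ge0.
rewrite /psum; under eq_bigr do rewrite exchange_big /=.
rewrite exchange_big /=; apply: ler_sum => i _.
under eq_bigr do rewrite exchange_big /=.
rewrite exchange_big /=; apply: ler_sum => j _.
under eq_bigr do rewrite -mulr_sumr.
rewrite -mulr_sumr ler_wpM2l ?nm_ge0 // exprD.
by apply: bndM => //; apply: bndX.
Qed.

End Norms.

Section Classes.
Variables (R : realType) (K : numClosedFieldType) (N : absval R K) (S : series K).
Implicit Types (f g h u v z w : S) (c : K) (n k : nat) (r M rho : R) (Phi Psi : S -> S -> S).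

Local Notation bnd := (bnd N).
Local Notation convergent := (convergent N).

Lemma convergent_bnd k f : convergent f -> inm k f ->
  exists M, exists2 r0, 0 < r0 & forall r, 0 < r -> r <= r0 -> bnd r (r ^+ k * M) f.
Proof.
move=> [r0 r0p [M fM]] fk; exists (M / r0 ^+ k), r0 => // r rp rr.
by have := bnd_inm rp rr fk fM; rewrite expr_div_n mulrAC mulrA.
Qed.

(* [cls k]: on balls of small radius [rho], for weights [r] small with respect
   to [rho], the operator has size O(rho ^ k); moreover its values vanish at the
   origin when k > 0, and it gains one order of vanishing when k = 2. Constant
   series vanishing at the origin have class 2, as [r] may be taken small. *)
Definition cls k Phi :=
  [/\ forall z w, inm 1 z -> inm 1 w -> inm (0 < k) (Phi z w),
      forall n z w z' w', inm 1 z -> inm 1 w -> inm 1 z' -> inm 1 w' ->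
        inm n (z - z') -> inm n (w - w') -> inm (n + k.-1) (Phi z w - Phi z' w') &
      exists2 M, 0 <= M & exists2 rho0, 0 < rho0 & forall rho, 0 < rho -> rho <= rho0 ->
        exists2 r0, 0 < r0 & forall r, 0 < r -> r <= r0 -> forall z w,
          inm 1 z -> inm 1 w -> bnd r rho z -> bnd r rho w ->
          bnd r (M * rho ^+ k) (Phi z w)].

Lemma cls_ext k Phi Psi :
  (forall z w, inm 1 z -> inm 1 w -> Phi z w = Psi z w) -> cls k Phi -> cls k Psi.
Proof.
move=> PP [im cg [M M0 [rho0 rho0p bd]]]; split=> [z w z1 w1|n z w z' w' z1 w1 z1' w1'|].
- by rewrite -PP //; apply: im.
- by rewrite -!PP //; apply: cg.
exists M => //; exists rho0 => // rho rhop /(bd _ rhop)[r0 r0p {}bd].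
by exists r0 => // r rp rr z w z1 w1; rewrite -PP //; apply: bd.
Qed.

Lemma cls_leq k Phi : cls k.+1 Phi -> cls k Phi.
Proof.
move=> [im cg [M M0 [rho0 rho0p bd]]]; split=> [z w z1 w1|n z w z' w' z1 w1 z1' w1' zz ww|].
- by apply: inm_leq (im _ _ z1 w1); case: (k).
- by apply: inm_leq (cg n _ _ _ _ z1 w1 z1' w1' zz ww); rewrite leq_add2l leq_pred.
exists M => //; exists (Num.min rho0 1); first by rewrite lt_min rho0p ltr01.
move=> rho rhop; rewrite le_min => /andP[/(bd _ rhop)[r0 r0p {}bd] rho1].
exists r0 => // r rp rr z w z1 w1 zb wb; apply: bnd_leM (bd r rp rr z w z1 w1 zb wb).
by rewrite ler_wpM2l // exprS ler_piMl // exprn_ge0 // ltW.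
Qed.

Lemma clsD k Phi Psi : cls k Phi -> cls k Psi -> cls k (fun z w => Phi z w + Psi z w).
Proof.
move=> [im cg [M M0 [rho0 rho0p bd]]] [im' cg' [M' M0' [rho0' rho0p' bd']]].
split=> [z w z1 w1|n z w z' w' z1 w1 z1' w1' zz ww|].
- by apply: inmD; [apply: im | apply: im'].
- by apply: modD; [apply: cg | apply: cg'].
exists (M + M'); first exact: addr_ge0.
exists (Num.min rho0 rho0'); first by rewrite lt_min rho0p.
move=> rho rhop; rewrite le_min => /andP[/(bd _ rhop)[r0 r0p {}bd] /(bd' _ rhop)[r0' r0p' {}bd']].
exists (Num.min r0 r0') => [|r rp]; first by rewrite lt_min r0p.
rewrite le_min => /andP[rr rr'] z w z1 w1 zb wb.
by rewrite mulrDl; apply: bndD; rewrite ?ltW //; [apply: bd | apply: bd'].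
Qed.

Lemma clsN k Phi : cls k Phi -> cls k (fun z w => - Phi z w).
Proof.
move=> [im cg [M M0 [rho0 rho0p bd]]].
split=> [z w z1 w1|n z w z' w' z1 w1 z1' w1' zz ww|].
- by apply/inmN/im.
- by apply/modN/cg.
exists M => //; exists rho0 => // rho rhop /(bd _ rhop)[r0 r0p {}bd].
by exists r0 => // r rp rr z w z1 w1 zb wb; apply: bndN; [exact: ltW | apply: bd].
Qed.

(** The powers of rho add up. For two factors of class 1, each difference is multiplied by a series
    without constant term, which yields the order gained in class 2. *)
Lemma clsM i j Phi Psi : (i + j <= 2)%N -> cls i Phi -> cls j Psi ->
  cls (i + j) (fun z w => Phi z w * Psi z w).
Proof.
move=> ij [im cg [M M0 [rho0 rho0p bd]]] [im' cg' [M' M0' [rho0' rho0p' bd']]].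
split=> [z w z1 w1|n z w z' w' z1 w1 z1' w1' zz ww|].
- apply: inm_leq (inmM (im _ _ z1 w1) (im' _ _ z1 w1)).
  by case: (i) => [|?]; case: (j).
- have P := cg n _ _ _ _ z1 w1 z1' w1' zz ww; have P' := cg' n _ _ _ _ z1 w1 z1' w1' zz ww.
  have I := im' _ _ z1 w1; have I' := im _ _ z1' w1'.
  rewrite (_ : _ - _ = (Phi z w - Phi z' w') * Psi z w + Phi z' w' * (Psi z w - Psi z' w')); last by ring.
  apply: inmD; [apply: inm_leq (inmM P I) | apply: inm_leq (inmM I' P')].
    by case: (i) (j) ij => [|[|[|?]]] [|[|[|?]]] //=; lia.
  by case: (i) (j) ij => [|[|[|?]]] [|[|[|?]]] //=; lia.
exists (M * M'); first exact: mulr_ge0.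
exists (Num.min rho0 rho0'); first by rewrite lt_min rho0p.
move=> rho rhop; rewrite le_min => /andP[/(bd _ rhop)[r0 r0p {}bd] /(bd' _ rhop)[r0' r0p' {}bd']].
exists (Num.min r0 r0') => [|r rp]; first by rewrite lt_min r0p.
rewrite le_min => /andP[rr rr'] z w z1 w1 zb wb.
by rewrite exprD mulrACA; apply: bndM; rewrite ?ltW //; [apply: bd | apply: bd'].
Qed.

Lemma cls_conv f : convergent f -> cls 0 (fun _ _ => f).
Proof.
move=> [r0 r0p [M fM]]; split=> [z w _ _|n z w z' w' *|]; first exact: inm0.
  exact: mod_refl.
exists M; first exact: bnd_ge0 fM.
exists 1 => // rho rhop _; exists r0 => // r rp rr z w _ _ _ _.
have := bnd_inm rp rr (@inm0 _ _ f) fM.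
by rewrite expr0 mul1r mulr1.
Qed.

Lemma cls_conv1 f : convergent f -> inm 1 f -> cls 2 (fun _ _ => f).
Proof.
move=> fc f1; have [M [r0 r0p fM]] := convergent_bnd fc f1.
split=> [z w _ _|n z w z' w' *|] //; first exact: mod_refl.
exists 1 => //; exists 1 => // rho rhop _.
have M0 : 0 <= M.
  by have /bnd_ge0 := fM r0 r0p (lexx _); rewrite expr1 pmulr_rge0.
(* This radius gives r M <= rho^2; the + 1 keeps the denominator positive. *)
exists (Num.min r0 (rho ^+ 2 / (M + 1))).
  by rewrite lt_min r0p divr_gt0 ?exprn_gt0 ?ltr_wpDl.
move=> r rp; rewrite le_min => /andP[rr]; rewrite ler_pdivlMr ?ltr_wpDl // => rM z w _ _ _ _.
apply: bnd_leM (fM r rp rr); rewrite expr1 mul1r; apply: le_trans rM.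
by rewrite ler_wpM2l ?lerDl // ltW.
Qed.

Lemma cls_fst : cls 1 (fun z _ => z).
Proof.
split=> // [n z w z' w'|]; first by rewrite addn0.
exists 1 => //; exists 1 => // rho rhop _; exists 1 => // r rp _ z w _ _ zb _.
by rewrite expr1 mul1r.
Qed.

Lemma cls_snd : cls 1 (fun _ w => w).
Proof.
split=> // [n z w z' w'|]; first by rewrite addn0.
exists 1 => //; exists 1 => // rho rhop _; exists 1 => // r rp _ z w _ _ _ wb.
by rewrite expr1 mul1r.
Qed.

(** Integration gains one order of vanishing and a factor [r], which may be taken small against
    rho^2; hence the jump from class 0 to class 2. *)
Lemma cls_iy Phi : cls 0 Phi -> cls 2 (fun z w => iy (Phi z w)).
Proof.
move=> [im cg [M M0 [rho0 rho0p bd]]].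
split=> [z w z1 w1|n z w z' w' z1 w1 z1' w1' zz ww|].
- by apply: inm_iy; apply: inm0.
- rewrite -iyB addn1; apply: inm_iy; rewrite -[n]addn0; exact: cg.
exists 1 => //; exists rho0 => // rho rhop /(bd _ rhop)[r0 r0p {}bd].
exists (Num.min r0 (rho ^+ 2 / (M + 1))).
  by rewrite lt_min r0p divr_gt0 ?exprn_gt0 ?ltr_wpDl.
move=> r rp; rewrite le_min => /andP[rr]; rewrite ler_pdivlMr ?ltr_wpDl // => rM z w z1 w1 zb wb.
have := bnd_iy (ltW rp) (bd r rp rr z w z1 w1 zb wb); apply: bnd_leM.
rewrite mul1r expr0 mulr1; apply: le_trans rM.
by rewrite ler_wpM2l ?lerDl // ltW.
Qed.

Lemma cls_subs0 f Phi Psi : convergent f -> cls 1 Phi -> cls 1 Psi ->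
  cls 0 (fun z w => subs f (Phi z w) (Psi z w)).
Proof.
move=> [R0 R0p [L fL]] [im cg [M M0 [rho0 rho0p bd]]] [im' cg' [M' M0' [rho0' rho0p' bd']]].
split=> [z w z1 w1|n z w z' w' z1 w1 z1' w1' zz ww|]; first exact: inm0.
- rewrite addn0; apply: mod_subs; do ?[exact: im|exact: im'].
    by rewrite -[n]addn0; apply: cg.
  by rewrite -[n]addn0; apply: cg'.
exists L; first exact: bnd_ge0 fL.
pose T := M + M' + 1.
have Tp : 0 < T by rewrite ltr_wpDl // addr_ge0.
(* The bound rho <= R0 / T keeps both arguments within [R0], a radius on which [f] is bounded. *)
exists (Num.min (Num.min rho0 rho0') (R0 / T)).
  by rewrite !lt_min rho0p rho0p' divr_gt0.
move=> rho rhop; rewrite !le_min => /andP[/andP[/(bd _ rhop)[r0 r0p {}bd] /(bd' _ rhop)[r0' r0p' {}bd']]].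
rewrite ler_pdivlMr // => rhoT.
exists (Num.min r0 r0') => [|r rp]; first by rewrite lt_min r0p.
rewrite le_min => /andP[rr rr'] z w z1 w1 zb wb.
rewrite expr0 mulr1; apply: (bnd_subs (r0 := R0)) => //; first exact: ltW.
  apply: bnd_leM (bd r rp rr z w z1 w1 zb wb); apply: le_trans rhoT.
  by rewrite expr1 mulrC ler_wpM2l ?(ltW rhop) // /T -addrA lerDl addr_ge0.
apply: bnd_leM (bd' r rp rr' z w z1 w1 zb wb); apply: le_trans rhoT.
by rewrite expr1 mulrC ler_wpM2l ?(ltW rhop) // /T -addrA addrCA lerDl addr_ge0.
Qed.

Lemma convergent_le f g : (forall i j, N (co g i j) <= N (co f i j)) ->
  convergent f -> convergent g.
Proof.
by move=> gf [r rp [M fM]]; exists r => //; exists M; apply: bnd_le gf fM; apply: ltW.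
Qed.

Lemma convergent_divx f : convergent f -> convergent (divx f).
Proof. by move=> [r rp [M fM]]; exists r => //; exists (M / r); apply: bnd_divx. Qed.

Lemma convergent_divy f : convergent f -> convergent (divy f).
Proof. by move=> [r rp [M fM]]; exists r => //; exists (M / r); apply: bnd_divy. Qed.

Lemma convergent_at_x0 f : convergent f -> convergent (at_x0 f).
Proof.
by apply: convergent_le => i j; rewrite co_mk; case: ifP; rewrite ?nm0 ?nm_ge0.
Qed.

Lemma cls_im k Phi z w : cls k.+1 Phi -> inm 1 z -> inm 1 w -> inm 1 (Phi z w).
Proof. by case=> im _ _; apply: im. Qed.

(** Splitting [f] as X f1 + Y f2 puts a factor [Phi] or [Psi] in front of a substitution of class
    0. *)
Lemma cls_subs1 k f Phi Psi : (k <= 1)%N -> convergent f -> inm 1 f ->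
    cls k.+1 Phi -> cls k.+1 Psi ->
  cls k.+1 (fun z w => subs f (Phi z w) (Psi z w)).
Proof.
move=> k1 fc f1 PhiP PsiP.
have [P1 Q1] : cls 1 Phi /\ cls 1 Psi.
  by case: k k1 PhiP PsiP => [|[|//]] _ ? ?; split=> //; apply: cls_leq.
apply: (@cls_ext _ (fun z w => subs (divx f) (Phi z w) (Psi z w) * Phi z w +
   subs (divy (at_x0 f)) (Phi z w) (Psi z w) * Psi z w)).
  move=> z w z1 w1; have Pm := cls_im PhiP z1 w1; have Qm := cls_im PsiP z1 w1.
  by rewrite [in RHS](inm_split f1) subsD !subsM // subs_x // subs_y //; ring.
apply: clsD; apply: (@clsM 0 k.+1) => //; apply: cls_subs0 => //.
  exact: convergent_divx.
exact/convergent_divy/convergent_at_x0.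
Qed.

Lemma cls_subs2 f Phi Psi : convergent f -> inm 2 f -> cls 1 Phi -> cls 1 Psi ->
  cls 2 (fun z w => subs f (Phi z w) (Psi z w)).
Proof.
move=> fc f2 P1 Q1.
apply: (@cls_ext _ (fun z w => subs (divx f) (Phi z w) (Psi z w) * Phi z w +
   subs (divy (at_x0 f)) (Phi z w) (Psi z w) * Psi z w)).
  move=> z w z1 w1; have Pm := cls_im P1 z1 w1; have Qm := cls_im Q1 z1 w1.
  by rewrite [in RHS](inm_split f2) subsD !subsM // subs_x // subs_y //; ring.
apply: clsD; apply: (@clsM 1 1) => //; apply: (@cls_subs1 0) => //.
- exact: convergent_divx.
- exact: inm_divx.
- exact/convergent_divy/convergent_at_x0.
- exact/inm_divy/inm_at_x0.
Qed.

(** Turns closure properties of the classes into closure properties of convergent series, seen as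
    constant operators. *)
Lemma conv_of_cls f : cls 0 (fun _ _ => f) -> convergent f.
Proof.
move=> [_ _ [M _ [rho rhop /(_ _ rhop (lexx _))[r rp bd]]]].
exists r => //; exists M; have Z := @inm_zero _ S 1.
have zb : bnd r rho (0 : S).
  move=> n; rewrite /psum big1 ?ltW // => i _; rewrite big1 // => j _.
  by rewrite co0 nm0 mul0r.
by have := bd r rp (lexx _) 0 0 Z Z zb zb; rewrite expr0 mulr1.
Qed.

(* An operator of class 2 maps a small ball to itself, and the truncation of the
   fixed point at order [n.+1] is determined by its truncation at order [n]: by
   induction all the truncations lie in the ball. *)
Lemma convergent_fixpoint Phi Psi z w : cls 2 Phi -> cls 2 Psi ->
    inm 1 z -> inm 1 w -> z = Phi z w -> w = Psi z w ->
  convergent z /\ convergent w.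
Proof.
move=> [im cg [M M0 [rho0 rho0p bd]]] [im' cg' [M' M0' [rho0' rho0p' bd']]] z1 w1 zE wE.
pose T := M + M' + 1.
have Tp : 0 < T by rewrite ltr_wpDl // addr_ge0.
(* The bound 1 / T makes M rho^2 and M' rho^2 at most rho, so the ball of radius rho is stable. *)
pose rho := Num.min (Num.min rho0 rho0') T^-1.
have rhop : 0 < rho by rewrite !lt_min rho0p rho0p' invr_gt0.
have [rho_le0 rho_le0' rhoT] : [/\ rho <= rho0, rho <= rho0' & rho <= T^-1].
  by have := lexx rho; rewrite {2}/rho !le_min => /andP[/andP[-> ->] ->].
have [r0 r0p {}bd] := bd rho rhop rho_le0; have [r0' r0p' {}bd'] := bd' rho rhop rho_le0'.
pose r := Num.min r0 r0'.
have rp : 0 < r by rewrite lt_min r0p.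
have [rr rr'] : r <= r0 /\ r <= r0'.
  by have := lexx r; rewrite {2}/r le_min => /andP[].
have small L : 0 <= L -> L <= T -> L * rho ^+ 2 <= rho.
  move=> L0 LT; rewrite expr2 mulrA ler_piMl ?(ltW rhop) //.
  rewrite -(mulfV (lt0r_neq0 Tp)); apply: ler_pM => //; exact: ltW.
have MT : M <= T by rewrite /T -addrA lerDl addr_ge0.
have MT' : M' <= T by rewrite /T -addrA addrCA lerDl addr_ge0.
pose tr n f : S := mk S (fun i j => if (i + j < n)%N then co f i j else 0).
have tr1 n f : inm 1 f -> inm 1 (tr n f).
  by move=> f1 i j ij; rewrite co_mk f1 ?if_same.
have trm n f : inm n (f - tr n f).
  by move=> i j ij; rewrite coB co_mk ij subrr.
have tr_eq n f g : inm n (f - g) -> tr n f = tr n g.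
  move=> fg; apply: co_inj => i j; rewrite !co_mk; case: ifP => // ij.
  by apply/eqP; rewrite -subr_eq0 -coB fg.
have trb n f L : bnd r L f -> bnd r L (tr n f).
  apply: bnd_le; first exact: ltW.
  by move=> i j; rewrite co_mk; case: ifP; rewrite ?nm0 ?nm_ge0.
have key n : bnd r rho (tr n z) /\ bnd r rho (tr n w).
  elim: n => [|n [zb wb]].
    have t0 f : tr 0%N f = 0 by apply: co_inj => i j; rewrite co_mk co0.
    by rewrite !t0; split=> n; rewrite /psum big1 ?(ltW rhop) // => i _; rewrite big1 // => j _;
       rewrite co0 nm0 mul0r.
  have zt := tr1 n _ z1; have wt := tr1 n _ w1.
  have ztn := trm n z; have wtn := trm n w.
  split; [rewrite zE | rewrite wE].
    rewrite (tr_eq _ _ (Phi (tr n z) (tr n w))); last by rewrite -addn1; apply: cg.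
    by apply: trb; apply: bnd_leM (bd r rp rr _ _ zt wt zb wb); apply: small.
  rewrite (tr_eq _ _ (Psi (tr n z) (tr n w))); last by rewrite -addn1; apply: cg'.
  by apply: trb; apply: bnd_leM (bd' r rp rr' _ _ zt wt zb wb); apply: small.
have fin f : (forall n, bnd r rho (tr n f)) -> bnd r rho f.
  move=> fb n; apply: le_trans (fb (n + n)%N n); apply: ler_sum => i _; apply: ler_sum => j _.
  have ij : (i + j < n + n)%N by rewrite -addSn leq_add // ltnW.
  by rewrite co_mk ij.
by split; exists r => //; exists rho; apply: fin => n; case: (key n).
Qed.

(** * Closure properties of convergent series *)

Lemma convergentD f g : convergent f -> convergent g -> convergent (f + g).
Proof. by move=> fc gc; apply/conv_of_cls/clsD; apply: cls_conv. Qed.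

Lemma convergentN f : convergent f -> convergent (- f).
Proof. by move=> fc; apply/conv_of_cls/clsN/cls_conv. Qed.

Lemma convergentM f g : convergent f -> convergent g -> convergent (f * g).
Proof. by move=> fc gc; apply/conv_of_cls/(@clsM 0 0) => //; apply: cls_conv. Qed.

Lemma convergent_const c : convergent (const c : S).
Proof. by exists 1 => //; exists (N c); apply: bnd_const. Qed.

Lemma convergentX : convergent (X : S).
Proof.
exists 1 => //; exists 1 => n; rewrite /psum.
apply: (le_trans (y := \sum_(i < n) \sum_(j < n) if (i == 1%N :> nat) && (j == 0%N :> nat) then 1 else 0)).
  apply: ler_sum => i _; apply: ler_sum => j _; rewrite expr1n mulr1 co_mk.
  by case: ifP; rewrite ?nm1 ?nm0.
by rewrite (sum_delta2 n 1 0 (fun _ _ => 1)); case: ifP.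
Qed.

Lemma convergentY : convergent (Y : S).
Proof.
exists 1 => //; exists 1 => n; rewrite /psum.
apply: (le_trans (y := \sum_(i < n) \sum_(j < n) if (i == 0%N :> nat) && (j == 1%N :> nat) then 1 else 0)).
  apply: ler_sum => i _; apply: ler_sum => j _; rewrite expr1n mulr1 co_mk.
  by case: ifP; rewrite ?nm1 ?nm0.
by rewrite (sum_delta2 n 0 1 (fun _ _ => 1)); case: ifP.
Qed.

Lemma convergent_subs f u v : convergent f -> convergent u -> convergent v ->
  inm 1 u -> inm 1 v -> convergent (subs f u v).
Proof.
move=> fc uc vc u1 v1; apply/conv_of_cls/cls_subs0 => //; exact/cls_leq/cls_conv1.
Qed.

(** Halving the radius absorbs the factor 2^(i + j), which dominates the integers produced by
    differentiation. *)
Lemma convergent_half f g : convergent f ->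
  (forall i j, N (co g i j) <= 2 ^+ (i + j) * N (co f i j)) -> convergent g.
Proof.
move=> [r rp [M fM]] gf; exists (r / 2); first by rewrite divr_gt0.
exists M => n; apply: le_trans (fM n); apply: ler_sum => i _; apply: ler_sum => j _.
rewrite expr_div_n mulrA ler_pdivrMr ?exprn_gt0 // mulrAC ler_wpM2r ?exprn_ge0 ?(ltW rp) //.
by rewrite mulrC; apply: gf.
Qed.

Lemma convergent_dx f : convergent f -> convergent (dx f).
Proof.
move=> fc; apply: (convergent_half (convergent_divx fc)) => i j.
rewrite !co_mk nmMn -[leLHS]mulr_natl.
rewrite ler_wpM2r ?nm_ge0 // -natrX ler_nat.
by apply: leq_trans (ltn_expl i (isT : 1 < 2)%N) _; rewrite leq_exp2l // leq_addr.
Qed.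

Lemma convergent_dy f : convergent f -> convergent (dy f).
Proof.
move=> fc; apply: (convergent_half (convergent_divy fc)) => i j.
rewrite !co_mk nmMn -[leLHS]mulr_natl.
rewrite ler_wpM2r ?nm_ge0 // -natrX ler_nat.
by apply: leq_trans (ltn_expl j (isT : 1 < 2)%N) _; rewrite leq_exp2l // leq_addl.
Qed.

Lemma convergent_inv f g : convergent f -> co f 0%N 0%N != 0 -> f * g = 1 -> convergent g.
Proof.
move=> fc f0 fg; set c := co f 0%N 0%N in f0.
pose b := const c^-1 * f - 1.
have b1 : inm 1 b.
  by apply/inm1P; rewrite /b coB co_constM co1 mulVf // subrr.
have bc : convergent b.
  apply: convergentD; first by apply: convergentM => //; apply: convergent_const.
  by apply: convergentN; rewrite -const1; apply: convergent_const.
pose z := const c * g - 1.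
have bz : (1 + b) * (1 + z) = 1.
  rewrite /b /z ![1 + (_ - 1)]addrC !subrK mulrACA -constM mulVf // const1 mul1r.
  exact: fg.
have zE : z = - b - b * z.
  by move/eqP: bz; rewrite -subr_eq0 => /eqP bz; rewrite -[RHS]addr0 -bz; ring.
have z1 : inm 1 z.
  by rewrite zE; apply: inmB; [apply: inmN | apply: inmMr].
have b2 := cls_conv1 bc b1.
have C1 : cls 2 (fun z _ => - b - b * z).
  apply: clsD; first exact: clsN.
  by apply: clsN; apply: (@clsM 2 0) => //; apply: cls_leq; apply: cls_fst.
(* The fixed point theorem is about pairs; with a single unknown, the second one is taken to be
   0. *)
have C2 : cls 2 (fun _ _ => 0).
  apply: cls_conv1; last exact: inm_zero.
  by rewrite -const0; apply: convergent_const.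
have [zc _] := convergent_fixpoint C1 C2 z1 (@inm_zero _ S 1) zE erefl.
have -> : g = const c^-1 * (1 + z).
  by rewrite /z addrC subrK mulrA -constM mulVf // const1 mul1r.
by apply: convergentM; [|apply: convergentD => //; rewrite -const1]; apply: convergent_const.
Qed.

End Classes.

(** * Restriction to the lines y = 0 and y = x *)

Section Lines.
Variables (K : numClosedFieldType) (S : series K).
Implicit Types (f g h u v : S) (c : K) (n : nat) (b : bool).

(* [line b] is y = 0 if [b] is [false] and y = x if [b] is [true]. *)
Definition line b : S := X *+ b.

Lemma inm_line b : inm 1 (line b).
Proof. by case: b; [exact: inmX1 | exact: inm_zero]. Qed.

(** The restriction is parametrized by x and kept in [S] as a series independent of y, so that the
    calculus of two variables still applies to it. *)
Definition rline b f : S := subs f X (line b).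

Lemma rlineD b f g : rline b (f + g) = rline b f + rline b g.
Proof. exact: subsD. Qed.

Lemma rlineN b f : rline b (- f) = - rline b f.
Proof. by apply: subsN; [exact: inmX1 | exact: inm_line]. Qed.

Lemma rlineB b f g : rline b (f - g) = rline b f - rline b g.
Proof. by rewrite rlineD rlineN. Qed.

Lemma rlineM b f g : rline b (f * g) = rline b f * rline b g.
Proof. by apply: subsM; [exact: inmX1 | exact: inm_line]. Qed.

Lemma rline_const b c : rline b (const c) = const c.
Proof. by apply: subs_const; [exact: inmX1 | exact: inm_line]. Qed.

Lemma rline0 b : rline b 0 = 0.
Proof. by rewrite -const0 rline_const. Qed.

Lemma rline1 b : rline b 1 = 1.
Proof. by rewrite -const1 rline_const. Qed.

Lemma rlineX b : rline b X = X.
Proof. by apply: subs_x; [exact: inmX1 | exact: inm_line]. Qed.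

Lemma rlineY b : rline b Y = line b.
Proof. by apply: subs_y; [exact: inmX1 | exact: inm_line]. Qed.

Lemma rlineMn b f m : rline b (f *+ m) = rline b f *+ m.
Proof.
by elim: m => [|m IHm]; rewrite ?mulr0n ?rline0 // !mulrS rlineD IHm.
Qed.

Lemma rline_sum b (I : Type) (r : seq I) (F : I -> S) :
  rline b (\sum_(k <- r) F k) = \sum_(k <- r) rline b (F k).
Proof. by apply: subs_sum; [exact: inmX1 | exact: inm_line]. Qed.

Lemma inm_rline b n f : inm n f -> inm n (rline b f).
Proof. by apply: inm_subs; [exact: inmX1 | exact: inm_line]. Qed.

Lemma rline_subs b f u v : inm 1 u -> inm 1 v ->
  rline b (subs f u v) = subs f (rline b u) (rline b v).
Proof. by move=> u1 v1; apply: subs_comp => //; [exact: inmX1 | exact: inm_line]. Qed.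

Lemma dx_rline b f : dx (rline b f) = rline b (dx f) + rline b (dy f) *+ b.
Proof.
rewrite dx_subs ?dxX; [|exact: inmX1 | exact: inm_line].
by rewrite mulr1 /line; case: b; rewrite ?mulr1n ?mulr0n ?dxX ?dx0 ?mulr1 ?mulr0.
Qed.

Lemma rline_vanish b f : rline b f = 0 -> rline b (dx f) = - (rline b (dy f) *+ b).
Proof.
by move=> f0; apply/eqP; rewrite -addr_eq0 -dx_rline f0 dx0.
Qed.

Lemma rlineE b f i j : (0 < j)%N -> co (rline b f) i j = 0.
Proof.
case: j => // j _.
have: dy (rline b f) = 0.
  rewrite dy_subs ?dyX; [|exact: inmX1 | exact: inm_line].
  by rewrite mulr0 add0r /line; case: b; rewrite ?mulr1n ?mulr0n ?dyX ?dy0 mulr0.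
move=> /(congr1 (fun f => co f i j)); rewrite co_mk co0 => /eqP.
by rewrite mulrn_eq0 /= => /eqP.
Qed.

Lemma xonly_split f : inm 1 f -> (forall i j, (0 < j)%N -> co f i j = 0) -> f = X * divx f.
Proof.
move=> f1 fx; apply: co_inj => [[|i]] j; rewrite co_XM ?co_mk //.
by case: j => [|j]; [apply: f1 | apply: fx].
Qed.

Lemma subs_rline b f u : inm 1 u -> subs (rline b f) u 0 = subs f u (u *+ b).
Proof.
move=> u1; have Z := @inm_zero _ S 1.
rewrite subs_comp ?subs_x //; [|exact: inmX1 | exact: inm_line].
by congr subs; rewrite /line; case: b; rewrite ?mulr0n ?mulr1n ?subs_x ?subs_0.
Qed.

Lemma co_rline b f : co (rline b f) 1%N 0%N = co f 1%N 0%N + co f 0%N 1%N *+ b.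
Proof.
rewrite co_subs_linear //; [|exact: inmX1 | exact: inm_line].
rewrite /line; case: b; rewrite ?mulr1n ?mulr0n ?co0 !co_mk /= ?mulr1 ?mulr0 //.
Qed.

Lemma at_y0_rline f : at_y0 f = rline false f.
Proof. exact: at_y0E. Qed.

Lemma rline_false f : rline false f = subs f X 0.
Proof. by []. Qed.

Lemma rline_id b f : rline false (rline b f) = rline b f.
Proof. by rewrite rline_false subs_rline //; exact: inmX1. Qed.

Lemma rline_iy f : rline false (iy f) = 0.
Proof.
rewrite -at_y0_rline; apply: co_inj => i j; rewrite co_mk co0.
by case: eqP => // ->; exact: co_mk.
Qed.

Lemma co00_rline b f : co (rline b f) 0%N 0%N = co f 0%N 0%N.
Proof. exact: co00_subs. Qed.

End Lines.

(** * Exponentials of vector fields *)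

Section Exponential.
Variables (K : numClosedFieldType) (S : series K).
Implicit Types (f g h u v p q : S) (c : K) (n : nat) (b : bool).

Definition derivation (V : S -> S) := [/\ forall f g, V (f + g) = V f + V g,
  forall c f, V (const c * f) = const c * V f &
  forall f g, V (f * g) = V f * g + f * V g].

Definition is_exp (V : S -> S) p q := forall g n, exists N0, forall N, (N0 <= N)%N ->
  inm n (subs g p q - \sum_(k < N) const (k`!%:R^-1) * iter k V g).

Variables (V : S -> S) (p q : S).
Hypotheses (dV : derivation V) (eV : is_exp V p q).

Lemma derivationE f : V f = V X * dx f + V Y * dy f.
Proof. by case: dV => A Z L; apply: derivE. Qed.

(** The tail is expressed through [V (V g)], so whatever is known of the square of [V] controls
    everything beyond the first order term. *)
Lemma exp_tail g n : exists r N, inm n r /\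
  subs g p q = g + V g + \sum_(k < N) const (k.+2`!%:R^-1) * iter k V (V (V g)) + r.
Proof.
have [N0 N0P] := eV g n.
exists (subs g p q - \sum_(k < N0.+2) const (k`!%:R^-1) * iter k V g), N0.
split; first by apply: N0P; rewrite -addn2 leq_addr.
rewrite !big_ord_recl /= !fact0 factS fact0 muln1 invr1 const1 !mul1r.
have -> : \sum_(i < N0) const (bump 0 (bump 0 i))`!%:R^-1 * iter (bump 0 (bump 0 i)) V g =
  \sum_(k < N0) const (k.+2`!%:R^-1) * iter k V (V (V g)).
  by apply: eq_bigr => k _; rewrite /bump !add1n -!iterSr.
ring.
Qed.

Hypotheses (p2 : inm 2 (p - X)) (q2 : inm 2 (q - Y)).
Hypotheses (VX1 : inm 1 (V X)) (VY1 : inm 1 (V Y)).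

Lemma inm_pq : inm 1 p /\ inm 1 q.
Proof.
split; [rewrite -[p](subrK X) | rewrite -[q](subrK Y)]; apply: inmD.
- exact: inm_leq p2.
- exact: inmX1.
- exact: inm_leq q2.
- exact: inmY1.
Qed.

(* Since exp V is the identity modulo m^2, if V^(k+1) maps m to m^2 then so does
   V^k; hence the linear part of V is zero as soon as it is nilpotent. *)
Lemma field_inm2 (k : nat) : (forall f, inm 1 f -> inm 2 (iter k V f)) ->
  inm 2 (V X) /\ inm 2 (V Y).
Proof.
have [p1 q1] := inm_pq.
have V1 f : inm 1 f -> inm 1 (V f).
  by move=> f1; rewrite derivationE; apply: inmD; apply: inmMr.
have subs2 f : inm 1 f -> inm 2 (subs f p q - f).
  move=> f1; rewrite (inm_split f1) subsD !subsM // subs_x // subs_y //.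
  set f1' := divx _; set f2' := divy _.
  have sm h : inm 1 (subs h p q - h).
    by apply/inm1P; rewrite coB co00_subs subrr.
  rewrite (_ : _ - _ = (p - X) * subs f1' p q + X * (subs f1' p q - f1') +
    ((q - Y) * subs f2' p q + Y * (subs f2' p q - f2'))); last by ring.
  apply: inmD; apply: inmD; do ?[exact: inmMr].
    by apply: (@inmM _ _ 1 1) => //; apply: inmX1.
  by apply: (@inmM _ _ 1 1) => //; apply: inmY1.
case: k => [|k].
  by move=> m12; split; apply: (m12).
elim: k => [|k IHk] Vk; first by split; apply: Vk; [exact: inmX1 | exact: inmY1].
apply: IHk => f f1.
set g := iter k V f.
have g1 : inm 1 g by rewrite /g; elim: (k) => // l IHl; apply: V1.
have [r [N [r2 E]]] := exp_tail g 2.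
have -> : iter k.+1 V f = subs g p q - g - \sum_(l < N) const (l.+2`!%:R^-1) * iter l V (V (V g)) - r.
  by rewrite E /= -/g; ring.
apply: inmB => //; apply: inmB; first exact: subs2.
apply: inm_sum => l _; apply: inmMl.
(* The term becomes the iterate of rank k + 2 of a series vanishing at 0, which has order 2 by
   hypothesis. *)
have -> : iter l V (V (V g)) = iter k.+2 V (iter l V f).
  by rewrite /g -!iterS -iterD -iterD addnC.
by apply: Vk; elim: (l : nat) => // m IHm; apply: V1.
Qed.

Hypotheses (VX2 : inm 2 (V X)) (VY2 : inm 2 (V Y)).

Lemma inm_field n f : inm n f -> inm n.+1 (V f).
Proof.
rewrite derivationE; case: n => [|n] fn.
  by apply: (@inm_leq _ _ 1 2) => //; apply: inmD; apply: inmMr.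
by apply: inmD; [apply: (inmM VX2 (inm_dx fn)) | apply: (inmM VY2 (inm_dy fn))].
Qed.

Lemma inm2_field f : inm 2 (V f).
Proof. by rewrite derivationE; apply: inmD; apply: inmMr. Qed.

Lemma inm_iter_field k n f : inm n f -> inm (k + n) (iter k V f).
Proof. by elim: k => // k IHk /IHk; apply: inm_field. Qed.

(** If [V f] has order n, the higher iterates have order n + 1, since [V] raises orders. As exp V
    fixes [f], [V f] is minus the tail and gains an order too. *)
Lemma invariant_first_integral f : subs f p q = f -> V f = 0.
Proof.
move=> fpq; apply: inm_eq0; elim=> [|n IHn]; first exact: inm0.
have [r [N [rn]]] := exp_tail f n.+1; rewrite fpq => E.
have -> : V f = - (\sum_(l < N) const (l.+2`!%:R^-1) * iter l V (V (V f)) + r).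
  by apply/eqP; rewrite -addr_eq0 addrA -(inj_eq (addrI f)) !addrA addr0 eq_sym; apply/eqP.
apply/inmN/inmD => //; apply: inm_sum => l _; apply: inmMl.
by apply: (inm_leq _ (@inm_iter_field l _ _ (inm_field IHn))); rewrite leq_addl.
Qed.

Variable b : bool.
Hypotheses (pb : rline b p = X) (qb : rline b q = line S b).

Lemma rline_exp g : rline b (subs g p q) = rline b g.
Proof. by have [p1 q1] := inm_pq; rewrite rline_subs // pb qb. Qed.

(** On the line exp V is the identity, so [V g] is minus the tail there. If [V X] and [V Y] have
    order n on the line, [V (V g)] has order n + 1 there, because the first derivatives of [V g]
    vanish at 0; hence the orders grow without bound. *)
Lemma rline_field f : rline b (V f) = 0.
Proof.
suff H n : inm n (rline b (V X)) /\ inm n (rline b (V Y)).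
  apply: inm_eq0 => n; have [HX HY] := H n.
  by rewrite derivationE rlineD !rlineM; apply: inmD; apply: inmMr.
elim: n => [|n [HX HY]]; first by split; apply: inm0.
have H2 g : inm n.+1 (rline b (V (V g))).
  rewrite derivationE rlineD !rlineM -addn1.
  by apply: inmD; apply: inmM => //; apply: inm_rline;
    [apply: inm_dx | apply: inm_dy]; apply: inm2_field.
have H1 g : inm n.+1 (rline b (V g)).
  have [r [N [rn E]]] := exp_tail g n.+1.
  have -> : V g = subs g p q - g - \sum_(l < N) const (l.+2`!%:R^-1) * iter l V (V (V g)) - r.
    by rewrite E; ring.
  rewrite !rlineB rline_exp subrr sub0r; apply: inmB; last exact: inm_rline.
  apply: inmN; rewrite rline_sum; apply: inm_sum => l _; rewrite rlineM; apply: inmMl.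
  by rewrite -!iterSr; apply: H2.
by split.
Qed.

(* The transversal eigenvalue of V along the line of fixed points y = b x. *)
Definition kappa : S := rline b (dy (V Y)) - rline b (dy (V X)) *+ b.

Lemma inm_kappa : inm 1 kappa.
Proof.
have H f : inm 1 (rline b (dy (V f))) by apply/inm_rline/inm_dy/inm2_field.
by apply: inmB => //; rewrite -mulr_natr; apply: inmMr.
Qed.

(** Along a line of zeros the linear part of [V] kills the tangent direction, so its trace is the
    transversal eigenvalue. *)
Lemma kappa_trace : rline b (dx (V X) + dy (V Y)) = kappa.
Proof. by rewrite rlineD (rline_vanish (rline_field X)) addrC. Qed.

(** On the line only the terms that differentiate [V X] and [V Y] survive, and dx f = - b dy f
    there. *)
Lemma kappa_field f : rline b f = 0 -> rline b (dy (V f)) = kappa * rline b (dy f).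
Proof.
move=> f0; rewrite derivationE dyD !dyM !rlineD !rlineM !rline_field !mul0r !addr0.
by rewrite (rline_vanish f0) /kappa; case: (b); rewrite ?mulr1n ?mulr0n; ring.
Qed.

Lemma kappa_iter k f : rline b f = 0 -> rline b (dy (iter k V f)) = kappa ^+ k * rline b (dy f).
Proof.
move=> f0; elim: k => [|k IHk]; first by rewrite expr0 mul1r.
have fk : rline b (iter k V f) = 0 by case: (k) => //= l; apply: rline_field.
by rewrite iterS kappa_field // IHk exprS mulrA.
Qed.

Definition exp_series : S := mk S (fun i j => if j == 0%N then i`!%:R^-1 else 0).

(** Apply d/dy along the line to exp V (y - b x) = q - b p: since y - b x vanishes on the line, the
    k-th iterate of [V] contributes kappa^k. *)
Lemma exp_kappa : subs exp_series kappa 0 = rline b (dy q) - rline b (dy p) *+ b.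
Proof.
have Z := @inm_zero _ S 1; have k1 := inm_kappa; have [p1 q1] := inm_pq.
apply/eqP; rewrite -subr_eq0; apply/eqP/inm_eq0 => n.
set f : S := Y - line S b.
have f0 : rline b f = 0.
  by rewrite /f rlineB rlineY rlineMn rlineX subrr.
have dylb : dy (line S b) = 0.
  by rewrite /line; case: (b); rewrite ?mulr1n ?mulr0n ?dyX ?dy0.
have df : rline b (dy f) = 1.
  have: dy f + dy (line S b) = 1 by rewrite -dyD subrK dyY.
  by rewrite dylb addr0 => ->; rewrite rline1.
(* The extra order is the one lost by [dy]; the rank of truncation must serve both exp V and the
   exponential series. *)
have [N0 N0P] := eV f n.+1.
pose N := maxn N0 n; have {N0P} := N0P N (leq_maxl _ _).
move=> /inm_dy /(inm_rline b).
have -> : subs f p q = q - p *+ b.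
  rewrite /f subsB // subs_y //; congr (_ - _).
  by rewrite /line; case: (b); rewrite ?mulr1n ?mulr0n ?subs_x ?subs_0.
have dySum (F : nat -> S) m : dy (\sum_(k < m) F k) = \sum_(k < m) dy (F k).
  apply: (big_morph (@dy K S)); first exact: dyD.
  exact: dy0.
rewrite dyB rlineB (dySum (fun k => const k`!%:R^-1 * iter k V f)) rline_sum.
have -> : dy (q - p *+ b) = dy q - dy p *+ b.
  by rewrite dyB; congr (_ - _); case: (b); rewrite ?mulr1n // !mulr0n dy0.
rewrite rlineB rlineMn.
under eq_bigr => k _ do rewrite dy_const rlineM rline_const kappa_iter // df mulr1.
set sm := \sum_(k < N) _ => H.
have H2 : inm n (subs exp_series kappa 0 - sm).
  pose t : S := \sum_(k < N) const (k`!%:R^-1) * X ^+ k.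
  have <- : subs t kappa 0 = sm.
    rewrite /t subs_sum //; apply: eq_bigr => k _.
    by rewrite subsM // subs_const // subsX // subs_x.
  rewrite -subsB //; apply: inm_leq (leq_maxr N0 n) _; apply: inm_subs => //.
  move=> i j ij; rewrite coB co_mk co_sum.
  under eq_bigr => k _ do rewrite co_constM -[X ^+ k]mulr1 co_XnM co1.
  have iN : (i < N)%N by apply: leq_ltn_trans ij; rewrite leq_addr.
  rewrite (bigD1 (Ordinal iN)) //= leqnn subnn /= big1 ?addr0.
    by case: (j == 0%N); rewrite ?mulr1 ?mulr0 subrr.
  move=> k; rewrite -val_eqE /= => ki; case: leqP => ki'; rewrite ?mulr0 //.
  by rewrite subn_eq0 leqNgt ltn_neqAle ki ki' /= mulr0.
rewrite (_ : _ - _ = (subs exp_series kappa 0 - sm) -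
  (rline b (dy q) - rline b (dy p) *+ b - sm)); last by ring.
exact: inmB.
Qed.

End Exponential.

(** * The foliation of a field vanishing on y = 0 and y = x *)

Section Foliation.
Variables (K : numClosedFieldType) (S : series K).
Implicit Types (f g h u v P Q A B T : S) (c : K) (n : nat) (b : bool).

Definition hh : S := Y * (Y - X).

Lemma subs_shear f : subs (subs f X (X + Y)) X (Y - X) = f.
Proof.
have X1 := @inmX1 K S; have Y1 := @inmY1 K S.
have XY1 : inm 1 (X + Y : S) by apply: inmD.
have YX1 : inm 1 (Y - X : S) by apply: inmB.
by rewrite subs_comp // subs_x // subsD subs_x // subs_y // addrC subrK subs_id.
Qed.

Lemma mulYX_eq0 f : (Y - X) * f = 0 -> f = 0.
Proof.
have X1 := @inmX1 K S; have Y1 := @inmY1 K S.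
have XY1 : inm 1 (X + Y : S) by apply: inmD.
have YX1 : inm 1 (Y - X : S) by apply: inmB.
move=> /(congr1 (fun g => subs g X (X + Y))); rewrite subsM // subsB // subs_y // subs_x //.
rewrite subs_0 // addrAC subrr add0r => /mulY_eq0 f0.
by rewrite -[f]subs_shear f0 subs_0.
Qed.

Lemma mulhh_eq0 f : hh * f = 0 -> f = 0.
Proof. by rewrite /hh -mulrA => /mulY_eq0 /mulYX_eq0. Qed.

Definition quothh f : S := subs (divy (subs (divy f) X (X + Y))) X (Y - X).

(* Vanishing on [y = x] becomes vanishing on [y = 0] in the coordinates [x], [y - x]. *)
Lemma quothhE f : (forall b, rline b f = 0) -> f = hh * quothh f.
Proof.
move=> f0; have X1 := @inmX1 K S; have Y1 := @inmY1 K S.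
have XY1 : inm 1 (X + Y : S) by apply: inmD.
have YX1 : inm 1 (Y - X : S) by apply: inmB.
have divY g : rline false g = 0 -> g = Y * divy g.
  by move=> g0; rewrite {1}[g]at_y0_divy at_y0_rline g0 add0r.
have E := divY f (f0 false).
have f1 : rline true (divy f) = 0.
  by apply: mulX_eq0; have := f0 true; rewrite {1}E rlineM rlineY.
have /divY E2 : rline false (subs (divy f) X (X + Y)) = 0.
  by rewrite rline_subs // rlineX rlineD rlineX rlineY /line mulr0n addr0 -{}f1.
rewrite {1}E /hh -mulrA; congr (_ * _); rewrite -{1}(subs_shear (divy f)) {1}E2.
by rewrite subsM // subs_y.
Qed.

(* The hypotheses say that (u, v) transforms the field (P, Q) / k into (P', Q'):
   along a common zero line their linear parts are then conjugate. *)
Lemma trace_conj b (k P Q P' Q' u v : S) :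
    inm 1 u -> inm 1 v ->
    rline b P = 0 -> rline b Q = 0 ->
    rline b (subs P' u v) = 0 -> rline b (subs Q' u v) = 0 ->
    k * subs P' u v = P * dx u + Q * dy u ->
    k * subs Q' u v = P * dx v + Q * dy v ->
    co u 1%N 0%N * co v 0%N 1%N - co u 0%N 1%N * co v 1%N 0%N != 0 ->
  rline b k * rline b (subs (dx P' + dy Q') u v) = rline b (dx P + dy Q).
Proof.
move=> u1 v1 P0 Q0 P0' Q0' EP EQ det.
have H (D : S -> S) f g : (forall f g, D (f + g) = D f + D g) ->
    (forall f g, D (f * g) = D f * g + f * D g) -> rline b (subs f u v) = 0 ->
    k * subs f u v = P * dx g + Q * dy g ->
  rline b k * rline b (D (subs f u v)) = rline b (D P) * rline b (dx g) + rline b (D Q) * rline b (dy g).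
  move=> DD DM f0 /(congr1 (fun h => rline b (D h))).
  rewrite DM DD !DM !rlineD !rlineM f0 P0 Q0 => E.
  by move: E; rewrite mulr0 !mul0r add0r !addr0.
have H1 := H _ _ _ (@dxD _ S) (@dxM _ S) P0' EP; have H2 := H _ _ _ (@dyD _ S) (@dyM _ S) P0' EP.
have H3 := H _ _ _ (@dxD _ S) (@dxM _ S) Q0' EQ; have H4 := H _ _ _ (@dyD _ S) (@dyM _ S) Q0' EQ.
move: H1 H2 H3 H4; rewrite !dx_subs // !dy_subs // subsD !rlineD !rlineM.
set k' := rline b k; set a11 := rline b (subs (dx P') u v); set a12 := rline b (subs (dy P') u v).
set a21 := rline b (subs (dx Q') u v); set a22 := rline b (subs (dy Q') u v).
set m11 := rline b (dx u); set m12 := rline b (dy u).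
set m21 := rline b (dx v); set m22 := rline b (dy v).
set p11 := rline b (dx P); set p12 := rline b (dy P).
set p21 := rline b (dx Q); set p22 := rline b (dy Q).
move=> H1 H2 H3 H4; apply/eqP; rewrite -subr_eq0; apply/eqP.
(* With M the Jacobian matrix of [(u, v)], A that of [(P', Q')] at [(u, v)] and L that of [(P, Q)],
   the hypotheses say k' A M = M L. The combination below is the trace of (k' A M - M L) adj(M),
   which is det(M) (k' tr A - tr L). *)
apply: (@mulr_cancel _ _ (m11 * m22 - m12 * m21)).
  rewrite coB !coM !big_ord1 !co00_rline !co_mk !mulr1n; exact: det.
rewrite (_ : _ * _ = (k' * (a11 * m11 + a12 * m21) - (p11 * m11 + p21 * m12)) * m22
   - (k' * (a11 * m12 + a12 * m22) - (p12 * m11 + p22 * m12)) * m21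
   - (k' * (a21 * m11 + a22 * m21) - (p11 * m21 + p21 * m22)) * m12
   + (k' * (a21 * m12 + a22 * m22) - (p12 * m21 + p22 * m22)) * m11); last by ring.
by rewrite H1 H2 H3 H4 !subrr !mul0r; ring.
Qed.

Lemma rline_hh b : rline b hh = 0.
Proof.
by rewrite /hh rlineM rlineB rlineY rlineX /line; case: b; rewrite ?mulr1n ?mulr0n; ring.
Qed.

(** Only the terms that differentiate [hh] survive on the lines; there its partial derivatives are -
    b x in x and (2 b - 1) x in y. *)
Lemma trace_hh b A B :
  co (rline b (dx (hh * A) + dy (hh * B))) 1%N 0%N =
  co B 0%N 0%N *+ b *+ 2 - co B 0%N 0%N - co A 0%N 0%N *+ b.
Proof.
have -> : rline b (dx (hh * A) + dy (hh * B)) =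
    X * ((rline b B *+ b *+ 2) - rline b B - rline b A *+ b).
  rewrite dxM dyM !rlineD 2!(rlineM b hh) rline_hh (rlineM b (dx hh)) (rlineM b (dy hh)).
  rewrite /hh dxM dyM dxB dyB dxX dxY dyX dyY.
  rewrite !rlineD !rlineM !rlineB rlineX rlineY rline0 rline1 /line.
  by case: b; rewrite ?mulr1n ?mulr0n; ring.
rewrite co_XM !coB.
have coMn f m : co (f *+ m) 0%N 0%N = co f 0%N 0%N *+ m.
  by elim: m => [|m IHm]; rewrite ?mulr0n ?co0 // !mulrS coD IHm.
by rewrite !coMn !co00_rline.
Qed.

(** Picard equation of dx/dy = T: eta(x, y) is the abscissa at height y of the leaf through (x,
    0). *)
Lemma flow_exists T : inm 1 T -> exists2 eta, inm 1 eta & eta = X + iy (subs T eta Y).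
Proof.
move=> T1; have X1 := @inmX1 K S; have Y1 := @inmY1 K S.
apply: (@fixpoint_exists _ _ 1 (fun z => X + iy (subs T z Y))) => [z z1|n z w z1 w1 zw].
  by apply: inmD => //; apply: inm_iy; apply: inm0.
apply: modD; first exact: mod_refl.
by rewrite -iyB; apply/inm_iy/mod_subs => //; apply: mod_refl.
Qed.

(** A first integral is constant along each leaf, and the leaf of eta(x, y) starts at (x, 0). *)
Lemma first_integral_flow T g eta : inm 1 eta -> eta = X + iy (subs T eta Y) ->
  T * dx g + dy g = 0 -> subs g eta Y = rline false g.
Proof.
move=> e1 eE Tg; have X1 := @inmX1 K S; have Y1 := @inmY1 K S; have Z := @inm_zero K S 1.
have dye : dy eta = subs T eta Y by rewrite {1}eE dyD dyX dy_iy add0r.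
have : dy (subs g eta Y) = 0.
  rewrite dy_subs // dye dyY mulr1.
  have := congr1 (fun f => subs f eta Y) Tg; rewrite subsD subsM // subs_0 // => <-; ring.
move=> /(congr1 (@iy K S)); rewrite iy_dy.
have -> : iy (0 : S) = 0 by have := iyB (0:S) 0; rewrite !subrr.
move/eqP; rewrite subr_eq0 => /eqP ->; rewrite at_y0E subs_comp // subs_y //.
congr (subs _ _ _).
by rewrite {1}eE -rline_false rlineD rline_iy rlineX addr0.
Qed.

(* If f(x,0) = rho^k, the solution of dy z = s dx z with initial value rho has
   k-th power f, because both solve the same Cauchy problem. *)
Lemma primitive_linear (s f : S) : inm 1 s -> dy f = s * dx f ->
    (forall k, (1 < k)%N -> ~ exists g, g ^+ k = f) ->
  co f 1%N 0%N != 0.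
Proof.
move=> s1 fE prim; apply/negP => /eqP f10.
set r := rline false f.
have rE : at_y0 f = r by rewrite at_y0_rline.
suff [k k1 [rho rhok]] : exists2 k, (1 < k)%N & exists g, g ^+ k = r.
  have contr := fun r n z w (_ : inm 0 z) (_ : inm 0 w) => @pde_contract K S s r n z w s1.
  have [|z _ zE] := fixpoint_exists _ (contr (rline false rho)); first by move=> z _; apply: inm0.
  have dyz : dy z = s * dx z.
    rewrite {1}zE dyD dy_iy (_ : dy (rline false rho) = 0) ?add0r //.
    by apply: co_inj => i j; rewrite co_mk rlineE // mul0rn co0.
  have dyzk m : dy (z ^+ m) = s * dx (z ^+ m).
    elim: m => [|m IHm]; first by rewrite expr0 dx1 dy1 mulr0.
    by rewrite exprS dxM dyM IHm dyz; ring.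
  have z0 : rline false z = rline false rho.
    by rewrite {1}zE rlineD rline_iy addr0 rline_id.
  have rlX (g : S) m : rline false (g ^+ m) = rline false g ^+ m.
    by apply: subsX; [exact: inmX1 | exact: inm_line].
  have zk0 : at_y0 (z ^+ k) = r.
    by rewrite at_y0_rline rlX z0 -rlX rhok /r rline_id.
  apply: (prim k k1); exists z.
  apply: (fixpoint_unique (contr r)); do ?exact: inm0.
    by rewrite -dyzk iy_dy zk0 addrC subrK.
  by rewrite -fE iy_dy rE addrC subrK.
have r_x i j : (0 < j)%N -> co r i j = 0 by apply: rlineE.
have r10 : co r 1%N 0%N = 0 by rewrite co_rline f10 add0r.
have [r0|[m rm]] : r = 0 \/ exists m, co r m 0%N != 0.
  have [[m rm]|nr] := pselect (exists m, co r m 0%N != 0); first by right; exists m.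
  left; apply: co_inj => i [|j]; last by rewrite co0 r_x.
  by rewrite co0; apply/eqP/negPn/negP => ri; case: nr; exists i.
  by exists 2 => //; exists 0; rewrite r0 expr0n.
have ex : exists m, co r m 0%N != 0 by exists m.
case: (ex_minnP ex) => {m rm ex} k rk kmin.
pose q : S := mk S (fun i j => co r (i + k)%N j).
have qE i j : co q i j = co r (i + k)%N j by apply: co_mk.
have rq : r = X ^+ k * q.
  apply: co_inj => i j; rewrite co_XnM qE; case: leqP => ik; first by rewrite subnK.
  case: j => [|j]; last by rewrite r_x.
  by apply/eqP; apply: contraTT ik => ri; rewrite -leqNgt; apply: kmin.
have q0 : co q 0%N 0%N != 0 by rewrite qE add0n.
(* The number [k] is the order of [r]: order 0 gives a square root, order 1 is excluded by [r10],
   and an order k >= 2 gives a k-th root, x times a k-th root of [q]. *)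
case: k rk {kmin} q {qE} rq q0 => [|[|k]] rk q rq q0.
- have [//|g gE] := @root_exists _ _ q 2 _ q0.
  by exists 2 => //; exists g; rewrite gE rq expr0 mul1r.
- by rewrite r10 eqxx in rk.
have [//|g gE] := @root_exists _ _ q k.+2 _ q0.
by exists k.+2 => //; exists (X * g); rewrite exprMn gE.
Qed.

End Foliation.

(** * Convergence of the data attached to a convergent field *)

Section ConvergentFoliation.
Variables (R : realType) (K : numClosedFieldType) (N : absval R K) (S : series K).
Implicit Types (f g h u v z w P Q A B T : S) (c : K) (n : nat) (b : bool).

Local Notation convergent := (convergent N).

Lemma convergent_line b : convergent (line S b).
Proof.
rewrite /line; case: b; rewrite ?mulr1n ?mulr0n; first exact: convergentX.
by rewrite -const0; apply: convergent_const.
Qed.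

Lemma convergentB f g : convergent f -> convergent g -> convergent (f - g).
Proof. by move=> fc gc; apply: convergentD => //; apply: convergentN. Qed.

Lemma convergentMn f m : convergent f -> convergent (f *+ m).
Proof.
move=> fc; elim: m => [|m IHm]; first by rewrite mulr0n -const0; apply: convergent_const.
by rewrite mulrS; apply: convergentD.
Qed.

Lemma convergent_rline b f : convergent f -> convergent (rline b f).
Proof.
move=> fc; apply: convergent_subs => //; [exact: convergentX | exact: convergent_line | |].
  exact: inmX1.
exact: inm_line.
Qed.

Lemma cls_zero : cls N 2 (fun _ _ => 0 : S).
Proof.
by apply: cls_conv1; [rewrite -const0; apply: convergent_const | apply: inm_zero].
Qed.

Lemma nm_inv_nat m : (0 < m)%N -> N (m%:R^-1) <= 1.
Proof.
move=> m0; have mK : m%:R != 0 :> K by rewrite pnatr_eq0 -lt0n.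
rewrite -(nm1 N) -[X in _ <= N X](mulVf mK) mulr_natr nmMn -[leLHS]mulr1n.
by rewrite ler_wpMn2l ?nm_ge0.
Qed.

Lemma convergent_exp : convergent (exp_series S).
Proof.
exists 2^-1; first by rewrite invr_gt0.
exists 2 => n; rewrite /psum.
have geo : \sum_(i < n) 2^-1 ^+ i = 2 - 2 * 2^-1 ^+ n :> R.
  elim: n => [|n IHn]; first by rewrite big_ord0 expr0 mulr1 subrr.
  rewrite big_ord_recr /= IHn exprS mulVKf ?pnatr_eq0 //.
  by rewrite mulr_natl mulr2n opprD addrA subrK.
apply: (@le_trans _ _ (\sum_(i < n) 2^-1 ^+ i : R)); last first.
  by rewrite geo gerBl mulr_ge0 // exprn_ge0 // invr_ge0.
apply: ler_sum => i _; case: n {geo} i => [[]//|n] i.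
rewrite big_ord_recl big1 ?addr0 => [|j _]; last by rewrite co_mk nm0 mul0r.
by rewrite co_mk addn0 ler_piMl ?exprn_ge0 ?invr_ge0 // nm_inv_nat // fact_gt0.
Qed.

(** The equation reads k = u - e2(k) with e2 = exp x - 1 - x of order 2, so its right-hand side has
    class 2. *)
Lemma convergent_log (k u : S) : inm 1 k -> subs (exp_series S) k 0 = 1 + u ->
  convergent u -> convergent k /\ co k 1%N 0%N = co u 1%N 0%N.
Proof.
move=> k1 ek uc; have Z := @inm_zero K S 1.
set e2 : S := exp_series S - 1 - X.
have e2m : inm 2 e2.
  move=> i j; rewrite !coB co_mk co1 co_mk.
  by case: i => [|[|i]]; case: j => [|[|j]] //= _; rewrite ?fact0 ?invr1 ?subrr ?subr0 ?subrr.
have e2c : convergent e2.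
  apply: convergentB; last exact: convergentX.
  by apply: convergentB; [exact: convergent_exp | rewrite -const1; apply: convergent_const].
have kE : k = u - subs e2 k 0.
  by rewrite /e2 !subsB // ek subs_1 // subs_x //; ring.
have u1 : inm 1 u.
  have -> : u = k + subs e2 k 0 by rewrite [in X in X + _]kE subrK.
  by apply: inmD => //; apply: (inm_leq (isT : 1 <= 2)%N); apply: inm_subs.
split; last first.
  rewrite {1}kE coB (_ : co (subs e2 k 0) 1%N 0%N = 0) ?subr0 //.
  by have := inm_subs k1 Z e2m; apply.
have C1 : cls N 2 (fun z _ => u - subs e2 z 0).
  apply: clsD; first exact: cls_conv1.
  by apply/clsN/cls_subs2 => //; [exact: cls_fst | exact/cls_leq/cls_zero].
by have [] := convergent_fixpoint C1 cls_zero k1 Z kE erefl.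
Qed.

Lemma convergent_flow T eta : convergent T -> inm 1 eta ->
  eta = X + iy (subs T eta Y) -> convergent eta.
Proof.
move=> Tc e1 eE.
have C1 : cls N 2 (fun z _ => X + iy (subs T z Y)).
  apply: clsD; first by apply: cls_conv1; [exact: convergentX | exact: inmX1].
  apply/cls_iy/cls_subs0 => //; first exact: cls_fst.
  by apply/cls_leq/cls_conv1; [exact: convergentY | exact: inmY1].
by have [] := convergent_fixpoint C1 cls_zero e1 (@inm_zero K S 1) eE erefl.
Qed.

(** Here [a] is the height at which the leaf through (x, 0) meets y = x; as eta - x has order 2, the
    implicit equation has class 2. *)
Lemma convergent_crossing (eta a : S) : convergent eta -> inm 2 (eta - X) -> inm 1 a ->
  a = subs eta X a -> convergent a.
Proof.
move=> ec e2 a1 aE; have X1 := @inmX1 K S.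
have aE' : a = X + subs (eta - X) X a by rewrite subsB // subs_x // -aE addrC subrK.
have Xc := cls_conv1 (convergentX N S) X1.
have C1 : cls N 2 (fun z _ => X + subs (eta - X) X z).
  apply: clsD => //; apply: cls_subs2 => //; last exact: cls_fst.
    by apply: convergentB => //; apply: convergentX.
  exact: cls_leq.
by have [] := convergent_fixpoint C1 cls_zero a1 (@inm_zero K S 1) aE' erefl.
Qed.

Lemma convergent_quothh f : convergent f -> convergent (quothh f).
Proof.
move=> fc; have X1 := @inmX1 K S; have Y1 := @inmY1 K S.
have Xc := convergentX N S; have Yc := convergentY N S.
have XY1 : inm 1 (X + Y : S) by apply: inmD.
have YX1 : inm 1 (Y - X : S) by apply: inmB.
apply: convergent_subs => //; last exact: convergentB.
apply/convergent_divy/convergent_subs => //; first exact: convergent_divy.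
exact: convergentD.
Qed.

Definition pt c z : S := X * (const c + z).

Lemma inm_pt c z : inm 1 (pt c z).
Proof. by apply: inmMr; apply: inmX1. Qed.

Lemma cls_subs_pt f c1 c2 : convergent f -> inm 1 f ->
  cls N 2 (fun z w => subs f (pt c1 z) (pt c2 w)).
Proof.
move=> fc f1.
have Xc := cls_conv1 (convergentX N S) (@inmX1 K S).
have C c : cls N 0 (fun _ _ => const c : S) by apply/cls_conv/convergent_const.
apply: (@cls_subs1 _ _ _ _ 1) => //; apply: (@clsM _ _ _ _ 2 0) => //; apply: clsD => //;
  apply: cls_leq; [exact: cls_fst | exact: cls_snd].
Qed.

(* Blow-up: writing the curve as [x (e + z)], the two equations become, after
   division by [x^2] and [x], a system with invertible linear part in [z]. *)
Lemma blowup_convergent (F D lam z w : S) (e1 e2 : K) :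
    convergent F -> convergent D -> convergent lam ->
    inm 2 F -> inm 1 D -> inm 1 z -> inm 1 w ->
    subs F (pt e1 z) (pt e2 w) = 0 -> subs D (pt e1 z) (pt e2 w) = X * lam ->
    (co F 2%N 0%N * e1 *+ 2 + co F 1%N 1%N * e2) * co D 0%N 1%N -
    (co F 1%N 1%N * e1 + co F 0%N 2%N * e2 *+ 2) * co D 1%N 0%N != 0 ->
  convergent z /\ convergent w.
Proof.
move=> Fc Dc lc F2 D1 z1 w1 F0 D0 det.
set u := pt e1 z in F0 D0; set v := pt e2 w in F0 D0.
have u1 : inm 1 u := inm_pt e1 z; have v1 : inm 1 v := inm_pt e2 w.
have split1 g : convergent g -> inm 1 g -> exists g1 g2, [/\ g = X * g1 + Y * g2,
    convergent g1, convergent g2 & forall k, inm k.+1 g -> inm k g1 /\ inm k g2].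
  move=> gc g1; exists (divx g), (divy (at_x0 g)); split.
  - exact: inm_split g1.
  - exact: convergent_divx.
  - exact/convergent_divy/convergent_at_x0.
  - by move=> k gk; split; [apply: inm_divx | apply/inm_divy/inm_at_x0].
have [Da [Db [DE Dac Dbc _]]] := split1 D Dc D1.
have [F1 [F2' [FE F1c F2c FF]]] := split1 F Fc (inm_leq (isT : 1 <= 2)%N F2).
have [F1m F2m] := FF _ F2.
have [Fa [Fb1 [F1E Fac Fb1c _]]] := split1 _ F1c F1m.
have [Fb2 [Fcc [F2E Fb2c Fccc _]]] := split1 _ F2c F2m.
(* Both splittings produce a term in x y; only their sum enters the quadratic part. *)
pose Fb := Fb1 + Fb2.
have Fbc : convergent Fb by apply: convergentD.
have FE' : F = X ^+ 2 * Fa + X * Y * Fb + Y ^+ 2 * Fcc.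
  by rewrite FE F1E F2E /Fb; ring.
clearbody Fb.
have XF f g h i j : co (X ^+ 2 * f + X * Y * g + Y ^+ 2 * h : S) i j =
    (if i is i'.+2 then co f i' j else 0) +
    (if i is i'.+1 then (if j is j'.+1 then co g i' j' else 0) else 0) +
    (if j is j'.+2 then co h i j' else 0).
  rewrite !coD !expr2 -!mulrA !co_XM !co_YM.
  by case: i => [|[|i]]; case: j => [|[|j]]; rewrite ?co_XM ?co_YM.
have [a0 b0 c0] : [/\ co Fa 0%N 0%N = co F 2%N 0%N, co Fb 0%N 0%N = co F 1%N 1%N &
    co Fcc 0%N 0%N = co F 0%N 2%N] by rewrite FE' !XF !add0r !addr0.
have [da0 db0] : co Da 0%N 0%N = co D 1%N 0%N /\ co Db 0%N 0%N = co D 0%N 1%N.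
  by rewrite DE !coD !co_XM !co_YM add0r addr0.
rewrite -{}a0 -{}b0 -{}c0 -{}da0 -{}db0 in det.
set a := co Fa 0%N 0%N in det; set b := co Fb 0%N 0%N in det; set c := co Fcc 0%N 0%N in det.
set d1 := co Da 0%N 0%N in det; set d2 := co Db 0%N 0%N in det.
pose Fa' := Fa - const a; pose Fb' := Fb - const b; pose Fc' := Fcc - const c.
pose Da' := Da - const d1; pose Db' := Db - const d2.
pose l0 := co lam 0%N 0%N; pose lam' := lam - const l0.
have [Fa1 Fb1' Fc1] : [/\ inm 1 Fa', inm 1 Fb' & inm 1 Fc'] by split; apply: inm_const0.
have [Da1 Db1 lam1] : [/\ inm 1 Da', inm 1 Db' & inm 1 lam'] by split; apply: inm_const0.
have cc := convergent_const N S.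
pose R1 z w := (const e1 + z) * (const e1 + z) * subs Fa' (pt e1 z) (pt e2 w) +
  (const e1 + z) * (const e2 + w) * subs Fb' (pt e1 z) (pt e2 w) +
  (const e2 + w) * (const e2 + w) * subs Fc' (pt e1 z) (pt e2 w).
pose Psi1 z w := - (const a * (z * z) + const b * (z * w) + const c * (w * w) + R1 z w).
pose Psi2 z w := lam' - ((const e1 + z) * subs Da' (pt e1 z) (pt e2 w) +
  (const e2 + w) * subs Db' (pt e1 z) (pt e2 w)).
have E1 : (const e1 + z) * (const e1 + z) * subs Fa u v + (const e1 + z) * (const e2 + w) * subs Fb u v
    + (const e2 + w) * (const e2 + w) * subs Fcc u v = 0.
  do 2 apply: mulX_eq0; transitivity (subs F u v); last exact: F0.
  rewrite FE' !expr2 !subsD !subsM // subs_x // subs_y //.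
  by rewrite /u /v /pt; ring.
have E2 : (const e1 + z) * subs Da u v + (const e2 + w) * subs Db u v = lam.
  apply/eqP; rewrite -subr_eq0; apply/eqP/mulX_eq0; rewrite mulrBr -D0 DE.
  by rewrite !subsD !subsM // subs_x // subs_y // /u /v /pt; ring.
have subsc f k : subs (f - const k) u v = subs f u v - const k.
  by rewrite subsB // subs_const.
(* [k1] and [k2] are the constant terms of the divided equations; subtracting them leaves equations
   without constant term in z and w. *)
have k1 : a * e1 ^+ 2 + b * e1 * e2 + c * e2 ^+ 2 = 0.
  have := congr1 (fun f => co f 0%N 0%N) E1.
  rewrite co0 !coD !coM !big_ord1 !subn0 !coM !big_ord1 !subn0 !coD !co_const /=.
  by rewrite (z1 0%N 0%N) // (w1 0%N 0%N) // !co00_subs -/a -/b -/c => <-; ring.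
have k2 : d1 * e1 + d2 * e2 = l0.
  rewrite /l0 -E2 !coD !coM !big_ord1 !subn0 !coD !co_const /=.
  by rewrite (z1 0%N 0%N) // (w1 0%N 0%N) // !co00_subs -/d1 -/d2; ring.
(* Gradient of the quadratic part of [F] at (e1, e2). *)
pose g1 := a * e1 *+ 2 + b * e2; pose g2 := b * e1 + c * e2 *+ 2.
have L1 : const g1 * z + const g2 * w = Psi1 z w.
  have H := congr1 (const (S := S)) k1.
  rewrite const0 !constD !expr2 !constM in H.
  apply/eqP; rewrite -subr_eq0; apply/eqP.
  transitivity ((const e1 + z) * (const e1 + z) * subs Fa u v +
    (const e1 + z) * (const e2 + w) * subs Fb u v + (const e2 + w) * (const e2 + w) * subs Fcc u v -
    (const a * (const e1 * const e1) + const b * const e1 * const e2 + const c * (const e2 * const e2))).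
    by rewrite /Psi1 /R1 -/u -/v /Fa' /Fb' /Fc' !subsc /g1 /g2 !mulr2n !constD !constM; ring.
  by rewrite E1 H subrr.
have L2 : const d1 * z + const d2 * w = Psi2 z w.
  have H := congr1 (const (S := S)) k2; rewrite constD !constM in H.
  rewrite /Psi2 /lam' -/u -/v /Da' /Db' !subsc -[in lam - _]E2 -H; ring.
set dl := g1 * d2 - g2 * d1 in det.
have cdl : const dl^-1 * const dl = 1 :> S by rewrite -constM mulVf // const1.
(* Cramer's rule inverts the linear part and leaves operators of class 2 on the right. *)
have zE : z = const dl^-1 * (const d2 * Psi1 z w - const g2 * Psi2 z w).
  rewrite -L1 -L2 -[LHS]mul1r -cdl /dl constD constN !constM; ring.
have wE : w = const dl^-1 * (const g1 * Psi2 z w - const d1 * Psi1 z w).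
  rewrite -L1 -L2 -[LHS]mul1r -cdl /dl constD constN !constM; ring.
have C k : cls N 0 (fun _ _ => const k : S) by apply: cls_conv.
have CM k Phi : cls N 2 Phi -> cls N 2 (fun z w => const k * Phi z w).
  by move=> P2; apply: (@clsM _ _ _ _ 0 2).
have Z0 k : cls N 0 (fun z _ : S => const k + z).
  by apply: clsD => //; apply/cls_leq/cls_fst.
have W0 k : cls N 0 (fun _ w : S => const k + w).
  by apply: clsD => //; apply/cls_leq/cls_snd.
have Fst := cls_fst N S; have Snd := cls_snd N S.
have QC Phi Psi f : cls N 0 Phi -> cls N 0 Psi -> convergent f -> inm 1 f ->
    cls N 2 (fun z w => Phi z w * Psi z w * subs f (pt e1 z) (pt e2 w)).
  move=> P0 Q0 fc f1; apply: (@clsM _ _ _ _ 0 2) => //; last exact: cls_subs_pt.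
  exact: (@clsM _ _ _ _ 0 0).
have QD Phi f : cls N 0 Phi -> convergent f -> inm 1 f ->
    cls N 2 (fun z w => Phi z w * subs f (pt e1 z) (pt e2 w)).
  by move=> P0 fc f1; apply: (@clsM _ _ _ _ 0 2) => //; apply: cls_subs_pt.
have P1 : cls N 2 Psi1.
  rewrite /Psi1 /R1; apply: clsN; apply: clsD; last first.
    by apply: clsD; [apply: clsD|]; apply: QC => //; apply: convergentB.
  by apply: clsD; [apply: clsD|]; apply: CM; apply: (@clsM _ _ _ _ 1 1).
have P2 : cls N 2 Psi2.
  apply: clsD; first by apply: cls_conv1 => //; apply: convergentB.
  by apply: clsN; apply: clsD; apply: QD => //; apply: convergentB.
have Q1 : cls N 2 (fun z w => const dl^-1 * (const d2 * Psi1 z w - const g2 * Psi2 z w)).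
  by apply: (CM _ _); apply: clsD; [|apply: clsN]; apply: (CM _ _).
have Q2 : cls N 2 (fun z w => const dl^-1 * (const g1 * Psi2 z w - const d1 * Psi1 z w)).
  by apply: (CM _ _); apply: clsD; [|apply: clsN]; apply: (CM _ _).
exact: (convergent_fixpoint Q1 Q2 z1 w1 zE wE).
Qed.

(** Let e be the tangent vector of the curve, D the divergence of (P, Q), and g the gradient at e of
    the quadratic part of F = P or Q. By Euler's identity g . e = 0, while dD . e is the nonzero
    linear coefficient of [k]; so g and dD are independent as soon as g is nonzero, and the blow-up
    applies to F. If g vanished for both P and Q, then dD . e, the sum of the x-component of g for P
    and the y-component of g for Q, would be 0. *)
Lemma convergent_singular_curve (P Q u v k : S) :
    convergent P -> convergent Q -> convergent k -> inm 2 P -> inm 2 Q ->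
    inm 1 u -> inm 1 v -> inm 1 k ->
    (forall i j, (0 < j)%N -> [/\ co u i j = 0, co v i j = 0 & co k i j = 0]) ->
    subs P u v = 0 -> subs Q u v = 0 -> subs (dx P + dy Q) u v = k ->
    co k 1%N 0%N != 0 ->
  convergent u /\ convergent v.
Proof.
move=> Pc Qc kc P2 Q2 u1 v1 k1 xo Pu Qu Du k10.
have uX : u = X * divx u by apply: xonly_split => // i j /(xo i)[].
have vX : v = X * divx v by apply: xonly_split => // i j /(xo i)[].
have kX : k = X * divx k by apply: xonly_split => // i j /(xo i)[].
set D := dx P + dy Q in Du.
have D1 : inm 1 D by apply: inmD; [apply: inm_dx | apply: inm_dy].
have Dc : convergent D by apply: convergentD; [apply: convergent_dx | apply: convergent_dy].
pose e1 := co u 1%N 0%N; pose e2 := co v 1%N 0%N.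
pose z := divx u - const e1; pose w := divx v - const e2.
have z1 : inm 1 z by apply/inm1P; rewrite coB co_const co_mk subrr.
have w1 : inm 1 w by apply/inm1P; rewrite coB co_const co_mk subrr.
have uE : u = pt e1 z by rewrite {1}uX /pt /z addrC subrK.
have vE : v = pt e2 w by rewrite {1}vX /pt /w addrC subrK.
have dE : co D 1%N 0%N * e1 + co D 0%N 1%N * e2 = co k 1%N 0%N.
  by rewrite -Du co_subs_linear.
have D10 : co D 1%N 0%N = co P 2%N 0%N *+ 2 + co Q 1%N 1%N by rewrite coD !co_mk.
have D01 : co D 0%N 1%N = co P 1%N 1%N + co Q 0%N 2%N *+ 2 by rewrite coD !co_mk.
have co10M f g : inm 1 f -> co (f * g) 1%N 0%N = co f 1%N 0%N * co g 0%N 0%N.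
  by move=> f1; rewrite coM !big_ord_recl !big_ord0 !addr0 (f1 0%N 0%N) // mul0r add0r.
have quad F : inm 2 F -> subs F u v = 0 ->
    (co F 2%N 0%N * e1 *+ 2 + co F 1%N 1%N * e2) * e1 +
    (co F 1%N 1%N * e1 + co F 0%N 2%N * e2 *+ 2) * e2 = 0.
  move=> F2 F0; have Fx1 := inm_dx F2; have Fy1 := inm_dy F2.
  have := congr1 (fun f => co (dx f) 1%N 0%N) F0; rewrite dx0 co0 dx_subs // coD.
  rewrite !co10M ?co_subs_linear //; [|exact: inm_subs | exact: inm_subs].
  by rewrite !co_mk => <-; rewrite /e1 /e2; ring.
have solve F : convergent F -> inm 2 F -> subs F u v = 0 ->
    (co F 2%N 0%N * e1 *+ 2 + co F 1%N 1%N * e2 != 0) ||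
    (co F 1%N 1%N * e1 + co F 0%N 2%N * e2 *+ 2 != 0) -> convergent u /\ convergent v.
  move=> Fc F2 F0 Fg; have := quad F F2 F0.
  set g1 := _ *+ 2 + _ in Fg *; set g2 := _ + _ *+ 2 in Fg * => ge.
  suff [zc wc] : convergent z /\ convergent w.
    have Cpt l h : convergent h -> convergent (pt l h).
      move=> hc; apply: convergentM; first exact: convergentX.
      by apply: convergentD => //; apply: convergent_const.
    by rewrite uE vE; split; apply: Cpt.
  have kc' : convergent (divx k) by apply: convergent_divx.
  apply: (blowup_convergent Fc Dc kc' F2 D1 z1 w1 (e1 := e1) (e2 := e2)); rewrite -?uE -?vE //.
    by rewrite -kX.
  apply: contraL Fg => /eqP; rewrite -/g1 -/g2 => det.
  have dk1 : g1 * co k 1%N 0%N = 0.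
    rewrite -dE; transitivity ((g1 * e1 + g2 * e2) * co D 1%N 0%N +
      (g1 * co D 0%N 1%N - g2 * co D 1%N 0%N) * e2); first by ring.
    by rewrite ge det !mul0r addr0.
  have dk2 : g2 * co k 1%N 0%N = 0.
    rewrite -dE; transitivity ((g1 * e1 + g2 * e2) * co D 0%N 1%N -
      (g1 * co D 0%N 1%N - g2 * co D 1%N 0%N) * e1); first by ring.
    by rewrite ge det !mul0r subr0.
  move/eqP: dk1; rewrite mulf_eq0 (negPf k10) orbF => /eqP ->.
  by move/eqP: dk2; rewrite mulf_eq0 (negPf k10) orbF => /eqP ->; rewrite eqxx.
have [gP|gP] := eqVneq (co P 2%N 0%N * e1 *+ 2 + co P 1%N 1%N * e2) 0; last first.
  by apply: (solve P) => //; rewrite gP.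
apply: (solve Q) => //; apply/orP; right; apply: contra_neq k10 => gQ.
rewrite -dE D10 D01 -[RHS]addr0 -{1}gP -gQ; ring.
Qed.

End ConvergentFoliation.

(** * The transport mapping *)

Section Transport.
Variables (R : realType) (K : numClosedFieldType) (N : absval R K) (S : series K).
Implicit Types (f g h u v z : S) (c : K) (n : nat) (b : bool).

Local Notation convergent := (convergent N).

(** Together with [invariant_first_integral], this makes being a first integral a property of the
    diffeomorphism and not of a chosen logarithm. *)
Lemma exp_fixed (V : S -> S) (p q f : S) : derivation V -> is_exp V p q -> V f = 0 ->
  subs f p q = f.
Proof.
move=> dV eV Vf; apply/eqP; rewrite -subr_eq0; apply/eqP/inm_eq0 => n.
have [r [m [rn ->]]] := exp_tail eV f n.
have V0 : V 0 = 0 by case: dV => VD _ _; apply: (addIr (V 0)); rewrite -VD !add0r.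
have it l : iter l V 0 = 0 by elim: l => //= l ->.
rewrite Vf V0 big1 => [|l _]; last by rewrite it mulr0.
by rewrite !addr0 addrAC subrr add0r.
Qed.

Lemma subs_00 f : subs f 0 0 = const (co f 0%N 0%N).
Proof.
have Z := @inm_zero K S 1.
have -> : f = const (co f 0%N 0%N) + (f - const (co f 0%N 0%N)) by ring.
rewrite (inm_split (inm_const0 f)) !subsD !subsM // subs_x // subs_y // subs_const //.
by rewrite !mul0r !addr0 !coD co_XM co_YM !addr0 co_const.
Qed.

(** The line y = 0 gives B(0), and the line y = x gives B(0) - A(0). *)
Lemma trace_values (A B : S) (k0 w0 : K) :
    (forall b, co (rline b (dx (hh S * A) + dy (hh S * B))) 1%N 0%N =
      k0 * (w0 *+ b *+ 2 - w0)) ->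
  co B 0%N 0%N = k0 * w0 /\ co A 0%N 0%N = 0.
Proof.
move=> H; have := H false; have := H true; rewrite !trace_hh !mulr1n !mulr0n.
set B0 := co B 0%N 0%N; set A0 := co A 0%N 0%N => H1 H0.
have B0E : B0 = k0 * w0.
  by rewrite (_ : B0 = - (0 *+ 2 - B0 - 0)); [rewrite H0; ring | ring].
split=> //; rewrite (_ : A0 = B0 - (B0 *+ 2 - B0 - A0)); last by ring.
by rewrite H1 B0E; ring.
Qed.

(** Dividing by the unit [B] gives the inverse slope dx/dy = A / B of leaves that are vertical at
    0. *)
Lemma slope_exists (A B : S) : co B 0%N 0%N != 0 -> co A 0%N 0%N = 0 ->
  exists T, [/\ inm 1 T, convergent A -> convergent B -> convergent T &
    forall f, A * dx f + B * dy f = 0 -> T * dx f + dy f = 0].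
Proof.
move=> B0 A0; have [Bi BBi] := inverse_exists B0.
exists (A * Bi); split.
- by apply: inmMr; apply/inm1P.
- by move=> Ac Bc; apply: convergentM => //; apply: convergent_inv BBi.
move=> f H; rewrite -[dy f]mul1r -BBi.
by rewrite (_ : _ + _ = Bi * (A * dx f + B * dy f)); [rewrite H mulr0 | ring].
Qed.

Variables (D w : S).
Hypotheses (Dc : convergent D) (wc : convergent w).
Hypotheses (w00 : co w 0%N 0%N != 0) (D00 : co D 0%N 0%N = 0).

Let p : S := X + hh S * D.
Let q : S := Y + hh S * w.

Let hh2 : inm 2 (hh S).
Proof. by apply: (@inmM _ _ 1 1); [exact: inmY1 | apply: inmB; [exact: inmY1 | exact: inmX1]]. Qed.

Let p2 : inm 2 (p - X).
Proof. by rewrite /p addrAC subrr add0r; apply: inmMr. Qed.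

Let q2 : inm 2 (q - Y).
Proof. by rewrite /q addrAC subrr add0r; apply: inmMr. Qed.

Let pb b : rline b p = X.
Proof. by rewrite rlineD rlineX rlineM rline_hh mul0r addr0. Qed.

Let qb b : rline b q = line S b.
Proof. by rewrite rlineD rlineY rlineM rline_hh mul0r addr0. Qed.

Variable V : S -> S.
Hypotheses (dV : derivation V) (eV : is_exp V p q).
Hypotheses (VX2 : inm 2 (V X)) (VY2 : inm 2 (V Y)).

Let VX1 : inm 1 (V X) := inm_leq (isT : 1 <= 2)%N VX2.
Let VY1 : inm 1 (V Y) := inm_leq (isT : 1 <= 2)%N VY2.

Let Vline b f : rline b (V f) = 0.
Proof. exact: (rline_field dV eV p2 q2 VX2 VY2 (pb b) (qb b)). Qed.

(** The exponential of kappa is the transversal derivative of [(p, q)], a convergent series, and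
    [convergent_log] takes its logarithm. The linear coefficient is - w(0) on y = 0 and w(0) on y =
    x, where D(0) = 0 removes the other term. *)
Lemma kappa_convergent b : [/\ convergent (kappa V b), inm 1 (kappa V b) &
  co (kappa V b) 1%N 0%N = co w 0%N 0%N *+ b *+ 2 - co w 0%N 0%N].
Proof.
have k1 : inm 1 (kappa V b) by apply: inm_kappa.
have hhc : convergent (hh S).
  by apply: convergentM; [exact: convergentY | apply: convergentB; [exact: convergentY | exact: convergentX]].
have gc g : convergent g -> convergent (rline b (dy (hh S * g))).
  by move=> gc; apply/convergent_rline/convergent_dy/convergentM.
have g10 g : co (rline b (dy (hh S * g))) 1%N 0%N = co g 0%N 0%N *+ b *+ 2 - co g 0%N 0%N.
  by have := trace_hh b 0 g; rewrite mulr0 dx0 add0r co0 mul0rn subr0.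
pose U := rline b (dy (hh S * w)) - rline b (dy (hh S * D)) *+ b.
have E : subs (exp_series S) (kappa V b) 0 = 1 + U.
  rewrite (exp_kappa dV eV p2 q2 VX2 VY2 (pb b) (qb b)) /p /q /U !dyD dyX dyY add0r.
  by rewrite rlineD rline1 addrA.
have Uc : convergent U by apply: convergentB; [exact: gc | apply/convergentMn/gc].
have [kc ->] := convergent_log k1 E Uc.
split=> //; rewrite /U coB g10; case: b {k1 U E Uc kc gc} g10 => g10; rewrite ?mulr1n ?mulr0n ?co0 ?subr0 //.
by rewrite g10 D00 mul0rn subr0 subr0.
Qed.

Lemma kappa_neq0 b : co (kappa V b) 1%N 0%N != 0.
Proof.
have [_ _ ->] := kappa_convergent b; case: b; rewrite ?mulr1n ?mulr0n.
  by rewrite mulr2n addrK.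
by rewrite mul0rn sub0r oppr_eq0.
Qed.

(** Divided by [hh], the field has components A and B with A(0) = 0 and B(0) = w(0), so [f] solves
    dy f = - T dx f with T(0) = 0, the setting of [primitive_linear]. *)
Lemma first_integral_linear f : V f = 0 ->
  (forall k, (1 < k)%N -> ~ exists g, g ^+ k = f) -> co f 1%N 0%N != 0.
Proof.
move=> Vf prim.
have AE := quothhE (fun b => Vline b X); have BE := quothhE (fun b => Vline b Y).
move: (quothh _) AE (quothh _) BE => A AE B BE.
have [|B0 A0] := @trace_values A B 1 (co w 0%N 0%N).
  move=> b; rewrite -AE -BE (kappa_trace dV eV p2 q2 VX2 VY2 (pb b) (qb b)) mul1r.
  by have [_ _ ->] := kappa_convergent b.
rewrite mul1r in B0; have B1 : co B 0%N 0%N != 0 by rewrite B0.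
have [T [T1 _ TE]] := slope_exists B1 A0.
apply: (@primitive_linear _ _ (- T)) prim; first exact: inmN.
apply/eqP; rewrite -subr_eq0 mulNr opprK addrC; apply/eqP/TE/mulhh_eq0.
by rewrite -Vf (derivationE dV) AE BE; ring.
Qed.

(** * The convergent field and the formal conjugacy *)

Variables (W : S -> S) (s1 s2 t1 t2 : S).
Hypotheses (dW : derivation W) (WXc : convergent (W X)) (WYc : convergent (W Y)).
Hypotheses (s1m : inm 1 s1) (s2m : inm 1 s2) (t1m : inm 1 t1) (t2m : inm 1 t2).
Hypotheses (ts1 : subs t1 s1 s2 = X) (ts2 : subs t2 s1 s2 = Y).
Hypothesis sdet : co s1 1%N 0%N * co s2 0%N 1%N - co s1 0%N 1%N * co s2 1%N 0%N != 0.
Hypothesis WV : forall g, W g = subs (V (subs g s1 s2)) t1 t2.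

Let Ws g : subs (W g) s1 s2 = V (subs g s1 s2).
Proof. by rewrite WV subs_comp // ts1 ts2 subs_id. Qed.

Let WX2 : inm 2 (W X).
Proof. by rewrite WV; apply: inm_subs => //; apply: (inm2_field dV VX2 VY2). Qed.

Let WY2 : inm 2 (W Y).
Proof. by rewrite WV; apply: inm_subs => //; apply: (inm2_field dV VX2 VY2). Qed.

Let Wline b g : rline b (subs (W g) s1 s2) = 0.
Proof. by rewrite Ws Vline. Qed.

Let trace_s b : rline b (subs (dx (W X) + dy (W Y)) s1 s2) = kappa V b.
Proof.
rewrite -(kappa_trace dV eV p2 q2 VX2 VY2 (pb b) (qb b)) -[LHS]mul1r -{1}(rline1 S b).
apply: (@trace_conj _ _ b 1 (V X) (V Y) (W X) (W Y) s1 s2) => //.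
- by rewrite mul1r Ws subs_x // (derivationE dV).
- by rewrite mul1r Ws subs_y // (derivationE dV).
Qed.

(** The image of the line is a curve of zeros of [W] along which the trace is the convergent series
    kappa; this determines its parametrization. *)
Let curve b : convergent (rline b s1) /\ convergent (rline b s2).
Proof.
have [kc k1 _] := kappa_convergent b.
apply: (convergent_singular_curve WXc WYc kc WX2 WY2 _ _ k1); last exact: kappa_neq0.
- exact: inm_rline.
- exact: inm_rline.
- by move=> i j j0; split; rewrite ?rlineE // coB rlineE // sub0r;
    case: b {kc k1}; rewrite ?mulr1n ?mulr0n ?co0 ?rlineE ?oppr0.
- by rewrite -rline_subs // Wline.
- by rewrite -rline_subs // Wline.
- by rewrite -rline_subs // trace_s.
Qed.

(* The map [psi] agrees with [s] on both lines, and is convergent because the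
   restrictions of [s] to them are. *)
Let psi (s : S) : S := subs (rline false s) (X - Y) 0 + subs (rline true s) Y 0.

Let XYm : inm 1 (X - Y : S).
Proof. by apply: inmB; [exact: inmX1 | exact: inmY1]. Qed.

Let psi_rline b s : inm 1 s -> rline b (psi s) = rline b s.
Proof.
move=> sm; have Z := @inm_zero K S 1; have Y1 := @inmY1 K S; have X1 := @inmX1 K S.
have s00 b' : subs (rline b' s) 0 0 = 0.
  by rewrite subs_00 co00_rline (sm 0%N 0%N) // const0.
rewrite /psi rlineD !rline_subs // rlineB rlineX rlineY rline0 /line.
case: b; rewrite ?mulr1n ?mulr0n ?subrr ?subr0 s00 ?add0r ?addr0.
  exact: rline_id true s.
exact: rline_id false s.
Qed.

Let psim s : inm 1 s -> inm 1 (psi s).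
Proof.
move=> sm; have Z := @inm_zero K S 1; have Y1 := @inmY1 K S.
by apply: inmD; apply: inm_subs => //; apply: inm_rline.
Qed.

(** A linear form is determined by its restrictions to the two lines. Thus [psi] keeps the nonzero
    Jacobian of [s] at 0. *)
Let psi_linear s : inm 1 s ->
  co (psi s) 1%N 0%N = co s 1%N 0%N /\ co (psi s) 0%N 1%N = co s 0%N 1%N.
Proof.
move=> sm; have Z := @inm_zero K S 1; have Y1 := @inmY1 K S.
rewrite /psi; move: (co_rline false s) (co_rline true s).
move: (rline false s) (rline true s) => r0 r1 E0 E1.
rewrite !coD !co_subs_linear // !coB !co0 E0 E1 !mulr0 !addr0 ?mulr1n ?mulr0n ?addr0.
by rewrite /X /Y !co_mk /=; split; ring.
Qed.

Let psic s : convergent (rline false s) -> convergent (rline true s) -> convergent (psi s).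
Proof.
move=> c0 c1; have Z := @inm_zero K S 1; have Y1 := @inmY1 K S.
have Zc : convergent (0 : S) by rewrite -const0; apply: convergent_const.
have Yc := convergentY N S.
apply: convergentD; apply: convergent_subs => //.
by apply: convergentB => //; apply: convergentX.
Qed.

Lemma transport_convergent f (a : S) : V f = 0 ->
    (forall k, (1 < k)%N -> ~ exists g, g ^+ k = f) ->
    inm 1 a -> subs f a a = subs f X 0 -> convergent a.
Proof.
move=> Vf prim am fa.
have X1 := @inmX1 K S; have Y1 := @inmY1 K S; have Z := @inm_zero K S 1.
have f10 := first_integral_linear Vf prim.
pose u := psi s1; pose v := psi s2.
have um : inm 1 u by apply: psim.
have vm : inm 1 v by apply: psim.
have [uc vc] : convergent u /\ convergent v.
  by split; apply: psic; case: (curve false); case: (curve true).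
have uvl b h : rline b (subs h u v) = rline b (subs h s1 s2).
  by rewrite !rline_subs // !psi_rline.
pose k := dx u * dy v - dy u * dx v.
have k00 : co k 0%N 0%N != 0.
  rewrite /k coB !coM !big_ord1 !subn0 !co_mk !mulr1n.
  by have [-> ->] := psi_linear s1m; have [-> ->] := psi_linear s2m.
pose P := subs (W X) u v; pose Q := subs (W Y) u v.
have Pc : convergent P by apply: convergent_subs.
have Qc : convergent Q by apply: convergent_subs.
(* Components of the pullback of [W] by [(u, v)], multiplied by the Jacobian [k] to avoid a
   division. *)
pose A' := dy v * P - dy u * Q; pose B' := dx u * Q - dx v * P.
have A'c : convergent A'.
  by apply: convergentB; apply: convergentM => //; apply: convergent_dy.
have B'c : convergent B'.
  by apply: convergentB; apply: convergentM => //; apply: convergent_dx.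
have PQ0 b : rline b P = 0 /\ rline b Q = 0 by rewrite /P /Q !uvl !Wline.
have A'0 b : rline b A' = 0.
  by have [P0 Q0] := PQ0 b; rewrite rlineB !rlineM P0 Q0 !mulr0 subrr.
have B'0 b : rline b B' = 0.
  by have [P0 Q0] := PQ0 b; rewrite rlineB !rlineM P0 Q0 !mulr0 subrr.
have AE := quothhE A'0; have Ac := convergent_quothh A'c.
have BE := quothhE B'0; have Bc := convergent_quothh B'c.
move: (quothh A') AE Ac (quothh B') BE Bc => A AE Ac B BE Bc.
(* The trace of this field along a line is [k] times kappa, whose linear coefficient is k(0) times
   that of kappa. *)
have [|B0 A0] := @trace_values A B (co k 0%N 0%N) (co w 0%N 0%N).
  move=> b; rewrite -AE -BE; have [P0 Q0] := PQ0 b.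
  have EP : k * subs (W X) u v = A' * dx u + B' * dy u by rewrite -/P /A' /B' /k; ring.
  have EQ : k * subs (W Y) u v = A' * dx v + B' * dy v by rewrite -/Q /A' /B' /k; ring.
  rewrite -(trace_conj um vm (A'0 b) (B'0 b) P0 Q0 EP EQ); last first.
    by have [-> ->] := psi_linear s1m; have [-> ->] := psi_linear s2m.
  have [_ k1 k10] := kappa_convergent b.
  rewrite uvl trace_s mulrC coM !big_ord_recl !big_ord0 (k1 0%N 0%N) // mul0r !addr0 add0r.
  by rewrite mulrC -k10; congr (_ * _); apply: co00_rline.
have B1 : co B 0%N 0%N != 0 by rewrite B0 mulf_neq0.
have [T [T1 Tc TE]] := slope_exists B1 A0.
have [eta eta1 etaE] := flow_exists T1.
have etac := convergent_flow (Tc Ac Bc) eta1 etaE.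
(* The conjugacy carries [f] to a first integral [g] of [W]; the pullback [G] of [g] by [(u, v)] is
   a first integral of the convergent foliation that agrees with [f] on both lines. *)
have [g gs] : exists g, subs g s1 s2 = f.
  by exists (subs f t1 t2); rewrite subs_comp // ts1 ts2 subs_id.
pose G := subs g u v.
have Wg : W X * dx g + W Y * dy g = 0.
  by rewrite -(derivationE dW) WV gs Vf subs_0.
have TG : T * dx G + dy G = 0.
  apply/TE/mulhh_eq0; rewrite mulrDr !mulrA -AE -BE /G dx_subs // dy_subs //.
  transitivity (k * (P * subs (dx g) u v + Q * subs (dy g) u v)).
    by rewrite /A' /B' /k; ring.
  by rewrite /P /Q -!subsM // -subsD Wg subs_0 // mulr0.
have Gl b : rline b G = rline b f by rewrite uvl gs.
have Gflow := first_integral_flow eta1 etaE TG.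
have G10 : co G 1%N 0%N != 0.
  by have := co_rline false G; rewrite Gl co_rline !mulr0n !addr0 => <-.
have a0 : a *+ false = 0 by [].
have Gaa : subs G a a = subs f a a.
  by rewrite -[X in subs G a X]mulr1n -(subs_rline true) // Gl subs_rline // mulr1n.
apply: (convergent_crossing etac) => //.
  rewrite etaE addrAC subrr add0r; apply: inm_iy; exact: inm_subs.
have e1 : inm 1 (subs eta X a) by apply: inm_subs.
(* Both points have height a and lie on the same level: G(a, a) = f(a, a) = f(x, 0) = G(x, 0) =
   G(eta(x, a), a), and [G] is injective in its first argument. *)
apply: (subs_inj1 G10 am e1 am).
rewrite Gaa fa -rline_false -Gl -Gflow.
have <- : subs (subs G eta Y) X a = subs G (subs eta X a) a.
  by rewrite subs_comp // subs_y.
rewrite Gflow {2}rline_false subs_comp // subs_x // subs_0 //.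
Qed.

End Transport.

(** * The series of the statement *)

Section Bridge.
#[local] Arguments co : simpl never.
Variable R : realType.
Local Notation C := R[i].
Implicit Types (f g : fps2 R) (c : C).

Lemma normc_ge0 c : 0 <= Normc.normc c.
Proof. by case: c => a b; apply: sqrtr_ge0. Qed.

Definition normc_absval : absval R C :=
  Absval normc_ge0 (Normc.normc0 R) (Normc.normc1 R) (@normcN R) (@Normc.normcM R)
    (@le_normcD R) (@normcMn R).

Fact fps2_coD f g i j : (f + g) i j = f i j + g i j.
Proof. by []. Qed.

Fact fps2_co1 i j : (1 : fps2 R) i j = ((i == 0%N) && (j == 0%N))%:R.
Proof. by case: i => [|i]; case: j => [|j]. Qed.

Fact fps2_coM f g i j : (f * g) i j =
  \sum_(k < i.+1) \sum_(l < j.+1) f k l * g (i - k)%N (j - l)%N.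
Proof.
rewrite {1}/GRing.mul /=.
apply: (big_morph (fun h : fps C => h j)) => [h k|] //.
by case: j.
Qed.

Fact fps2_inj f g : (forall i j, f i j = g i j) -> f = g.
Proof. by move=> fg; apply/fpsP => i; apply/fpsP => j. Qed.

Definition fps2_series : series C :=
  @Series C (fps2 R) (fun f i j => f i j) (fun F => Fps (fun i => Fps (F i)))
    (fun _ _ _ => erefl) fps2_inj fps2_coD fps2_co1 fps2_coM.

Local Notation S := fps2_series.
Local Notation N := normc_absval.

Lemma varxE : varx = X :> S.
Proof. by apply: (co_inj (s := S)) => [[|[|i]]] [|j]. Qed.

Lemma varyE : vary = Y :> S.
Proof. by apply: (co_inj (s := S)) => [[|i]] [|[|j]]. Qed.

Lemma cstE c : Defs.cst c = const c :> S.
Proof. by apply: (co_inj (s := S)) => [[|i]] [|j]. Qed.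

Lemma subst2E (f : S) (s : fps2 R * fps2 R) : subst2 f s = subs f (s.1 : S) (s.2 : S) :> S.
Proof. by apply: (co_inj (s := S)). Qed.

Lemma inm1E (f : S) : f 0%N 0%N = 0 -> inm 1 f.
Proof. by move=> f0; apply/inm1P. Qed.

Lemma summable_bounded (T : choiceType) (u : T -> R) : (forall x, 0 <= u x) ->
  summable [set: T] (fun x => (u x)%:E) ->
  exists M : R, forall r : seq T, uniq r -> \sum_(x <- r) u x <= M.
Proof.
move=> u0 su; set s := (\esum_(x in [set: T]) `|(u x)%:E|)%E in su.
have s0 : (0 <= s)%E by apply: esum_ge0.
have fs : s \is a fin_num by rewrite ge0_fin_numE.
exists (fine s) => r ur; rewrite -lee_fin fineK //.
apply: esum_ge; exists [set` r]%classic; first by split=> //; apply: finite_seq.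
rewrite -fsbig_seq // -sumEFin; apply: lee_sum => x _.
by rewrite abse_EFin ger0_norm.
Qed.

Lemma convergent2E (f : S) : convergent2 f -> convergent N f.
Proof.
move=> [r r0 /summable_bounded[|M MP]].
  by move=> k; rewrite mulr_ge0 ?normc_ge0 ?exprn_ge0 ?ltW.
exists r => //; exists M => n.
have /MP : uniq [seq (i, j) | i <- index_iota 0 n, j <- index_iota 0 n].
  by apply: allpairs_uniq; rewrite ?iota_uniq // => -[? ?] [? ?].
apply: le_trans; rewrite big_allpairs_dep /= /psum.
by rewrite big_mkord; apply: ler_sum => i _; rewrite big_mkord.
Qed.

(** Series in one variable are embedded as series independent of y, so that the convergence results
    in two variables apply to them. *)
Definition iota1 (a : fps C) : S := mk S (fun i j => if j == 0%N then a i else 0).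

Lemma convergent1E (a : fps C) : convergent N (iota1 a) -> convergent1 a.
Proof.
move=> [r r0 [M MP]]; exists r => //; rewrite /summable.
have t0 n : 0 <= Normc.normc (a n) * r ^+ n.
  by rewrite mulr_ge0 ?normc_ge0 ?exprn_ge0 ?ltW.
rewrite -nneseries_esumT //; apply: (@le_lt_trans _ _ M%:E); last exact: ltry.
apply: lime_le; first exact: is_cvg_nneseries.
apply: nearW => n; under eq_bigr do rewrite abse_EFin ger0_norm //.
rewrite sumEFin lee_fin; apply: le_trans (MP n.+1); rewrite big_mkord /psum big_ord_recr /=.
apply: ler_wpDr.
  by apply: sumr_ge0 => j _; rewrite mulr_ge0 ?normc_ge0 ?exprn_ge0 ?ltW.
apply: ler_sum => i _; rewrite big_ord_recl /= addn0; apply: ler_wpDr => //.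
by apply: sumr_ge0 => j _; rewrite mulr_ge0 ?sqrtr_ge0 ?exprn_ge0 // ltW.
Qed.

Lemma co_iota1 (a : fps C) i j : co (iota1 a) i j = if j == 0%N then a i else 0.
Proof. exact: co_mk. Qed.

Lemma iota1M (a b : fps C) : iota1 (a * b) = iota1 a * iota1 b.
Proof.
apply: co_inj => i j; rewrite coM co_iota1.
have -> : (a * b) i = \sum_(k < i.+1) a k * b (i - k)%N by [].
case: j => [|j] /=.
  by apply: eq_bigr => k _; rewrite big_ord1 !co_iota1.
rewrite big1 // => k _; rewrite big1 // => l _; rewrite !co_iota1.
case: (l : nat) => [|m] /=; first by rewrite ?subn0 mulr0.
by rewrite mul0r.
Qed.

Lemma iota1_1 : iota1 1 = 1.
Proof. by apply: co_inj => i j; rewrite co_iota1 co1; case: j => [|j]; case: i => [|i]. Qed.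

Lemma iota1_X : iota1 fpsX = X.
Proof. by apply: co_inj => i j; rewrite co_iota1 co_mk andbC; case: j => [|j]; case: i => [|[|i]]. Qed.

Lemma iota1_0 : iota1 0 = 0.
Proof. by apply: co_inj => i j; rewrite co_iota1 co0; case: j => [|j]; case: i => [|i]. Qed.

Lemma iota1X (a : fps C) k : iota1 (a ^+ k) = iota1 a ^+ k.
Proof. by elim: k => [|k IHk]; rewrite ?iota1_1 // !exprS iota1M IHk. Qed.

Lemma iota1_subst1 (f : S) (a b : fps C) :
  iota1 (subst1 f a b) = subs f (iota1 a) (iota1 b).
Proof.
apply: co_inj => i j; rewrite co_iota1 /subs co_mk.
have E k l : iota1 a ^+ k * iota1 b ^+ l = iota1 (a ^+ k * b ^+ l).
  by rewrite iota1M !iota1X.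
case: j => [|j] /=.
  rewrite addn0; apply: eq_bigr => k _; apply: eq_bigr => l _.
  by rewrite E co_iota1.
by rewrite big1 // => k _; rewrite big1 // => l _; rewrite E co_iota1 /= mulr0.
Qed.

(** Only finitely many coefficients lie below order n, so coefficientwise stabilization is uniform
    there. *)
Lemma formal_sum_mod (u : nat -> S) (s : S) n : formal_sum u s ->
  exists N0, forall m, (N0 <= m)%N -> inm n (s - \sum_(k < m) u k).
Proof.
move=> us.
have /choice[M MP] (ij : nat * nat) :
    exists M, forall m, (M <= m)%N -> co (\sum_(k < m) u k) ij.1 ij.2 = co s ij.1 ij.2.
  by have [M _ MP] := us ij.1 ij.2; exists M => m; apply: MP.
exists (\max_(i < n) \max_(j < n) M (i : nat, j : nat)) => m Mm i j ijn.
have [iN jN] : (i < n)%N /\ (j < n)%N by lia.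
rewrite coB (MP (i, j)) ?subrr //; apply: leq_trans Mm.
apply: leq_trans (leq_bigmax (Ordinal iN)).
exact: (leq_bigmax (F := fun j : 'I_n => M (i, j : nat)) (Ordinal jN)).
Qed.

Lemma formal_vector_fieldE (V : S -> S) : formal_vector_field V -> derivation V.
Proof. by move=> [VD VZ VL]; split=> // c f; rewrite -cstE; apply: VZ. Qed.

Lemma is_logE (s : fps2 R * fps2 R) (V : S -> S) : is_log s V ->
  derivation V /\ is_exp V (s.1 : S) (s.2 : S).
Proof.
move=> [_ [/formal_vector_fieldE dV _ _] Vs]; split=> // g n.
have [N0 NP] := formal_sum_mod n (Vs g); exists N0 => m /NP.
by rewrite subst2E; under eq_bigr do rewrite cstE.
Qed.

(** On series vanishing at 0, [V] acts on linear parts by right multiplication with its nilpotent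
    matrix; hence some iterate of [V] raises their order to 2 and [field_inm2] applies. *)
Lemma is_log_inm2 (s : fps2 R * fps2 R) (V : S -> S) :
  inm 2 ((s.1 : S) - X) -> inm 2 ((s.2 : S) - Y) -> is_log s V ->
  inm 2 (V X) /\ inm 2 (V Y).
Proof.
move=> s1 s2 Vs; have [dV eV] := is_logE Vs.
have [_ [_ [VX0 VY0] [k Ak]] _] := Vs.
have VX1 : inm 1 (V X) by rewrite -varxE; apply: inm1E VX0.
have VY1 : inm 1 (V Y) by rewrite -varyE; apply: inm1E VY0.
apply: (field_inm2 dV eV s1 s2 VX1 VY1 (k := k)) => f f1.
set A := linear_part _ in Ak.
pose lin (h : S) : 'rV[C]_2 := \row_(l < 2) (if l == 0 then co h 1%N 0%N else co h 0%N 1%N).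
have co_lin (u h : S) i j : (i + j = 1)%N -> inm 1 u -> co (u * h) i j = co u i j * co h 0%N 0%N.
  by case: i j => [|[|i]] [|[|j]] //= _ u1; rewrite coM !big_ord_recl !big_ord0 !addr0
    (u1 0%N 0%N) // mul0r add0r.
have linV h : inm 1 h -> inm 1 (V h) /\ lin (V h) = lin h *m A.
  move=> h1; split.
    by rewrite (derivationE dV); apply: inmD; apply: inmMr.
  apply/rowP => l; rewrite !mxE !big_ord_recl big_ord0 addr0 !mxE /=.
  have E i j : (i + j = 1)%N -> co (V h) i j = co h 1%N 0%N * co (V X) i j + co h 0%N 1%N * co (V Y) i j.
    move=> ij; rewrite (derivationE dV) coD !co_lin // !co_mk !mulr1n.
    by rewrite [co h 1%N 0%N * _]mulrC [co h 0%N 1%N * _]mulrC.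
  rewrite /components /= varxE varyE.
  by case: eqP => _; rewrite E.
have it m : inm 1 (iter m V f) /\ lin (iter m V f) = lin f *m A ^+ m.
  elim: m => [|m [m1 mE]]; first by rewrite expr0 mulmx1.
  by have [? E] := linV _ m1; split=> //; rewrite iterS E mE exprSr mulmxA.
have [fk1 fk] := it k; rewrite Ak mulmx0 in fk.
move=> i j; case: i => [|[|i]]; case: j => [|[|j]] // _; first exact: fk1.
  by have /rowP/(_ 1) := fk; rewrite !mxE.
by have /rowP/(_ 0) := fk; rewrite !mxE.
Qed.

Lemma formal_diffeoE (s : fps2 R * fps2 R) : formal_diffeo s ->
  [/\ inm 1 (s.1 : S), inm 1 (s.2 : S) &
    co (s.1 : S) 1%N 0%N * co (s.2 : S) 0%N 1%N - co (s.1 : S) 0%N 1%N * co (s.2 : S) 1%N 0%N != 0].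
Proof.
move=> [[/inm1E s1 /inm1E s2]]; rewrite unitmxE unitfE.
rewrite (expand_det_row _ ord0) !big_ord_recl big_ord0 addr0 /cofactor !det_mx11 !mxE /=.
by rewrite expr0 expr1 mul1r mulN1r mulrN; split.
Qed.

End Bridge.

Theorem proposition1p1 (R : realType) (Delta w : fps2 R)
    (cDelta : convergent2 Delta) (cw : convergent2 w)
    (w00 : w 0%N 0%N != 0) (Delta00 : Delta 0%N 0%N = 0)
    (emb : embeddable (phi Delta w)) (a : fps R[i])
    (Tr_a : is_transport Delta w a) :
  convergent1 a.
Proof.
pose S := fps2_series R.
case: emb => V [W [logV [fW WXc WYc] [s [t [/formal_diffeoE[s1 s2 sdet] /formal_diffeoE[t1 t2 _] _ ts WE]]]]].
case: Tr_a => V2 [f [logV2 Vf prim a0 fa]].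
apply: convergent1E; set al := iota1 a.
have phiE1 : (phi Delta w).1 = X + hh S * (Delta : S) by rewrite -varxE /hh -varxE -varyE.
have phiE2 : (phi Delta w).2 = Y + hh S * (w : S) by rewrite -varyE /hh -varxE -varyE.
have h2 : inm 2 (hh S).
  by apply: (@inmM _ _ 1 1); [exact: inmY1 | apply: inmB; [exact: inmY1 | exact: inmX1]].
have p2 : inm 2 (((phi Delta w).1 : S) - X).
  by rewrite phiE1 addrAC subrr add0r; apply: inmMr.
have q2 : inm 2 (((phi Delta w).2 : S) - Y).
  by rewrite phiE2 addrAC subrr add0r; apply: inmMr.
have [VX2 VY2] := is_log_inm2 p2 q2 logV.
have [dV eV] := is_logE logV; have [dV2 eV2] := is_logE logV2.
(* The logarithms in the two hypotheses are given separately; a first integral of [V2] is invariant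
   under the diffeomorphism, hence a first integral of [V]. *)
have Vf0 : V f = 0.
  apply: (invariant_first_integral dV eV VX2 VY2).
  exact: (exp_fixed dV2 eV2).
rewrite phiE1 phiE2 in eV.
have dW := formal_vector_fieldE fW.
rewrite varxE in WXc; rewrite varyE in WYc.
have ts1 : subs (t.1 : S) (s.1 : S) (s.2 : S) = X.
  by rewrite -subst2E -varxE; exact: (congr1 fst ts).
have ts2 : subs (t.2 : S) (s.1 : S) (s.2 : S) = Y.
  by rewrite -subst2E -varyE; exact: (congr1 snd ts).
have WE' (g : S) : W g = subs (V (subs g (s.1 : S) (s.2 : S)) : S) (t.1 : S) (t.2 : S).
  by rewrite WE !subst2E.
have al1 : inm 1 al by apply: inm1E; rewrite /= a0.
have fal : subs (f : S) al al = subs (f : S) X 0.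
  rewrite /al -(iota1_subst1 f a a) fa (iota1_subst1 f fpsX 0).
  exact: (f_equal2 (subs (f : S)) (iota1_X R) (iota1_0 R)).
exact: (transport_convergent (N := normc_absval R) (convergent2E cDelta) (convergent2E cw) w00 Delta00
  dV eV VX2 VY2 dW (convergent2E WXc) (convergent2E WYc) s1 s2 t1 t2 ts1 ts2 sdet WE' Vf0 prim al1 fal).
Qed.
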